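(* Let $R$ be a ring. The following conditions on $R$ are equivalent. (i) Every Gorenstein projective $R^\circ$-module is Gorenstein flat. (ii) For every $R^\circ$-module $M$ that has a complete projective resolution and for all $i\in\mathbb{Z}$ there are isomorphisms of functors on the category of $R$-modules, $$\check{\operatorname{Tor}}{}^{R}_{i}(M,-)\;\cong\;\widehat{\operatorname{Tor}}{}^{R}_{i}(M,-),$$ where $\check{\operatorname{Tor}}{}^R(M,-)$ denotes complete homology and $\widehat{\operatorname{Tor}}{}^R(M,-)$ denotes Tate homology.
   Context: Rings are associative unital algebras over a fixed commutative ring $\Bbbk$. An $R$-module is a left $R$-module; right $R$-modules are viewed as modules over the opposite ring $R^\circ$. Functors go from $R$-modules to $\Bbbk$-modules. J-completion. A morphism $\upsilon\colon \{U_i\}_{i\in\mathbb Z}\to\{T_i\}_{i\in\mathbb Z}$ of families of covariant functors is a family of natural transformations $\upsilon_i\colon U_i\to T_i$. The J-completion of a family $T=\{T_i\}_{i\in\mathbb Z}$ of covariant functors is a family $\check T=\{\check T_i\}_{i\in\mathbb Z}$ of covariant functors together with a morphism $\tau\colon\check T\to T$ such that (1) $\check T_i(E)=0$ for every injective $R$-module $E$ and every $i$; (2) if $U=\{U_i\}_{i\in\mathbb Z}$ is a family of covariant functors with $U_i(E)=0$ for every injective $R$-module $E$ and all $i$, and $\upsilon\colon U\to T$ is a morphism, then there is a unique morphism $\sigma\colon U\to\check T$ with $\tau\sigma=\upsilon$. It is unique up to unique isomorphism, and it exists for $T=\operatorname{Tor}^R(M,-)=\{\operatorname{Tor}_i^R(M,-)\}_{i\in\mathbb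 Z}$ (with $\operatorname{Tor}_i=0$ for $i<0$). Complete homology. For an $R^\circ$-module $M$, $\check{\operatorname{Tor}}{}^R(M,-)=\{\check{\operatorname{Tor}}{}^R_i(M,-)\}_{i\in\mathbb Z}$ is the J-completion of $\operatorname{Tor}^R(M,-)$. Gorenstein modules. An acyclic complex $T$ of projective $R^\circ$-modules is totally acyclic if $\operatorname{Hom}_{R^\circ}(T,P)$ is acyclic for every projective $R^\circ$-module $P$. An $R^\circ$-module $G$ is Gorenstein projective if there is a totally acyclic complex $T$ of projective $R^\circ$-modules with $\operatorname{Coker}(T_1\to T_0)\cong G$. An $R^\circ$-module $G$ is Gorenstein flat if there is an acyclic complex $T$ of flat $R^\circ$-modules with $\operatorname{Coker}(T_1\to T_0)\cong G$ and such that $T\otimes_R E$ is acyclic for every injective $R$-module $E$. Tate homology. A complete projective resolution of an $R^\circ$-module $M$ is a diagram $T\xrightarrow{\varpi}P\xrightarrow{\simeq}M$, where $T$ is a totally acyclic complex of projective $R^\circ$-modules, $P\to M$ is a projective resolution, and $\varpi$ is a chain map with $\varpi_i$ an isomorphism for all $i\gg0$. If $M$ has a complete projective resolution $T\to P\to M$ and $N$ is an $R$-module, then $\widehat{\operatorname{Tor}}{}^R_i(M,N)=H_i(T\otimes_R N)$ for $i\in\mathbb Z$.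
   Formalization: In the J-completion, families carry natural connecting maps that morphisms respect, and U and Ť must be exact on sequences 0→N→E→C→0 with E injective; for unconnected families the stated equivalence is false, e.g. R=F[x]/(x²), M=F. *)

(* Defs.v *)
From HB Require Import structures.
From mathcomp Require Import all_boot all_order all_algebra.
From mathcomp Require Import boolp classical_sets functions.

Set Implicit Arguments.
Unset Strict Implicit.
Unset Printing Implicit Defensive.

Import Order.TTheory GRing.Theory Num.Theory.
Local Open Scope ring_scope.
Local Open Scope quotient_scope.

Section Kernel.
Variables (A : pzRingType) (V W : lmodType A) (f : {linear V -> W}).

Definition ker_pred : {pred V} := fun v => f v == 0.
Lemma ker_pred_closed : submod_closed ker_pred.
Proof.
split=> [|a u v]; first by apply/eqP; rewrite linear0.
by move=> /eqP fu /eqP fv; apply/eqP; rewrite linearP fu fv scaler0 addr0.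
Qed.
HB.instance Definition _ :=
  GRing.isSubmodClosed.Build A V ker_pred ker_pred_closed.

Definition kernel := {v : V | ker_pred v}.
HB.instance Definition _ := SubChoice.on kernel.
HB.instance Definition _ := [SubChoice_isSubLmodule of kernel by <:].

Lemma kernelP (x : kernel) : f (val x) = 0.
Proof. exact/eqP/(valP x). Qed.

Lemma kernel_mem v : f v = 0 -> ker_pred v. Proof. by move=> /eqP. Qed.
Definition to_kernel v (fv : f v = 0) : kernel := exist _ v (kernel_mem fv).

End Kernel.

Section Cokernel.
Variables (A : pzRingType) (V W : lmodType A) (f : {linear V -> W}).

Definition im_pred : {pred W} := fun w => `[< exists v, f v = w >].
Lemma im_pred_closed : submod_closed im_pred.
Proof.
split=> [|a u v]; first by apply/asboolP; exists 0; rewrite linear0.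
move=> /asboolP[x <-] /asboolP[y <-]; apply/asboolP; exists (a *: x + y).
by rewrite linearP.
Qed.
HB.instance Definition _ :=
  GRing.isSubmodClosed.Build A W im_pred im_pred_closed.

Definition cokernel := Quotient.quot im_pred.
HB.instance Definition _ := GRing.Zmodule.on cokernel.
HB.instance Definition _ := EqQuotient.on cokernel.

Definition to_coker (w : W) : cokernel := \pi_cokernel w.

Lemma to_coker_zmod : zmod_morphism to_coker.
Proof. by move=> x y; rewrite /to_coker !piE. Qed.
HB.instance Definition _ :=
  GRing.isZmodMorphism.Build W cokernel to_coker to_coker_zmod.

Lemma to_coker_surj x : exists w, to_coker w = x.
Proof. by exists (repr x); exact: reprK. Qed.

Lemma to_coker_eq0 w : to_coker w = 0 <-> exists v, f v = w.
Proof.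
have -> : (to_coker w = 0) <-> (to_coker w == to_coker 0).
  by rewrite raddf0; split=> [->//|/eqP].
rewrite /to_coker -[X in X <-> _]/(is_true (_ == _ %[mod Quotient.quot im_pred])).
rewrite -Quotient.idealrBE subr0; split=> [/asboolP//|?]; exact/asboolP.
Qed.

Lemma to_coker_eq w w' : to_coker w = to_coker w' <-> exists v, f v = w - w'.
Proof.
rewrite -to_coker_eq0 raddfB; split=> /eqP.
  by rewrite -subr_eq0 => /eqP.
by rewrite subr_eq0 => /eqP.
Qed.

Definition coker_scale (a : A) (x : cokernel) : cokernel := to_coker (a *: repr x).

Lemma coker_scaleE a w : coker_scale a (to_coker w) = to_coker (a *: w).
Proof.
apply/to_coker_eq; rewrite -scalerBr.
have /to_coker_eq[v fv] : to_coker (repr (to_coker w)) = to_coker w by exact: reprK.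
by exists (a *: v); rewrite linearZ/= fv.
Qed.

Lemma coker_scaleA a b x : coker_scale a (coker_scale b x) = coker_scale (a * b) x.
Proof. by have [w <-] := to_coker_surj x; rewrite !coker_scaleE scalerA. Qed.
Lemma coker_scale1 : left_id 1 coker_scale.
Proof. by move=> x; have [w <-] := to_coker_surj x; rewrite coker_scaleE scale1r. Qed.
Lemma coker_scaleDr : right_distributive coker_scale +%R.
Proof.
move=> a x y; have [w <-] := to_coker_surj x; have [v <-] := to_coker_surj y.
by rewrite -raddfD !coker_scaleE scalerDr raddfD.
Qed.
Lemma coker_scaleDl x : {morph coker_scale^~ x : a b / a + b}.
Proof.
move=> a b; have [w <-] := to_coker_surj x.
by rewrite !coker_scaleE scalerDl raddfD.
Qed.
HB.instance Definition _ := GRing.Zmodule_isLmodule.Build A cokernel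
  coker_scaleA coker_scale1 coker_scaleDr coker_scaleDl.

Lemma to_coker_scalable : scalable to_coker.
Proof. by move=> a w; rewrite -coker_scaleE. Qed.
HB.instance Definition _ :=
  GRing.isScalable.Build A W cokernel *:%R to_coker to_coker_scalable.
End Cokernel.

Section CokernelLift.
Variables (A : pzRingType) (V W Z : lmodType A) (f : {linear V -> W}).
Variables (h : {linear W -> Z}) (hf : forall v, h (f v) = 0).

(* The hypothesis [hf] is what makes [coker_lift] linear. *)
Definition coker_lift (x : cokernel f) : Z :=
  let _ := hf in h (repr x).

Lemma coker_liftE w : coker_lift (to_coker f w) = h w.
Proof.
have /to_coker_eq[v fv] : to_coker f (repr (to_coker f w)) = to_coker f w.
  exact: reprK.
by apply/eqP; rewrite /coker_lift -subr_eq0 -linearB -fv hf.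
Qed.

Lemma coker_lift_linear : linear coker_lift.
Proof.
move=> a x y; have [v <-] := to_coker_surj x; have [w <-] := to_coker_surj y.
by rewrite -linearP !coker_liftE linearP.
Qed.
HB.instance Definition _ :=
  GRing.isLinear.Build A (cokernel f) Z *:%R coker_lift coker_lift_linear.
End CokernelLift.

Lemma linear_of_rel (A : pzRingType) (U V : lmodType A) (L : U -> V -> Prop) :
  (forall u, exists v, L u v) ->
  (forall a u v u' v', L u v -> L u' v' -> L (a *: u + u') (a *: v + v')) ->
  (forall v, L 0 v -> v = 0) ->
  exists f : {linear U -> V}, forall u v, L u v <-> f u = v.
Proof.
move=> Ltot Llin L0.
have Luniq u v v' : L u v -> L u v' -> v = v'.
  move=> Lv Lv'; have := Llin (-1) _ _ _ _ Lv Lv'.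
  rewrite scaleN1r addNr => /L0 /eqP; rewrite scaleN1r addrC subr_eq0.
  by move/eqP.
pose f u := projT1 (cid (Ltot u)).
have Lf u : L u (f u) by rewrite /f; case: cid.
have flin : linear f by move=> a u v; apply: Luniq (Lf _) (Llin _ _ _ _ _ _ _).
pose F : {linear U -> V} := HB.pack f (GRing.isLinear.Build _ _ _ _ f flin).
exists F => u v; split=> [Luv|<-]; [exact: Luniq (Lf u) Luv|exact: Lf].
Qed.

(* Homologically graded. The differential is a whole family [diff i j] that
   vanishes unless [i = j + 1]; this avoids transporting along equalities such
   as [i - 1 + 1 = i] in the type of [diff]. *)
Record complex (A : pzRingType) := Complex {
  cpx_obj :> int -> lmodType A;
  diff : forall i j, {linear cpx_obj i -> cpx_obj j};
  diff_shape : forall i j x, i <> j + 1 -> diff i j x = 0;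
  diff_diff : forall i j l x, diff j l (diff i j x) = 0 }.

Record chain_map (A : pzRingType) (X Y : complex A) := ChainMap {
  chain_fun :> forall i, {linear X i -> Y i};
  chain_diff : forall i j x, chain_fun j (diff X i j x) = diff Y i j (chain_fun i x) }.

Definition acyclic (A : pzRingType) (X : complex A) :=
  forall i (x : X i), diff X i (i - 1) x = 0 -> exists y, diff X (i + 1) i y = x.

Section Homology.
Variables (A : pzRingType) (X : complex A) (i : int).

Definition cycles := kernel (diff X i (i - 1)).
HB.instance Definition _ := GRing.Lmodule.on cycles.
HB.instance Definition _ := SubChoice.on cycles.

Definition boundary (x : X (i + 1)) : cycles := to_kernel (diff_diff i (i - 1) x).
Lemma boundary_linear : linear boundary.
Proof. by move=> a x y; apply: val_inj; rewrite /= !linearP. Qed.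
HB.instance Definition _ :=
  GRing.isLinear.Build A (X (i + 1)) cycles *:%R boundary boundary_linear.

Definition homology := cokernel boundary.
HB.instance Definition _ := GRing.Lmodule.on homology.

Definition hclass (z : cycles) : homology := to_coker boundary z.
Lemma hclass_linear : linear hclass.
Proof. exact: linearP. Qed.
HB.instance Definition _ :=
  GRing.isLinear.Build A cycles homology *:%R hclass hclass_linear.

End Homology.

Section HomologyTheory.
Variables (A : pzRingType).
Implicit Types X Y Z : complex A.

Lemma diff_eqj X i j l (x : X i) : j = l -> diff X i j x = 0 -> diff X i l x = 0.
Proof. by move->. Qed.

Lemma cycle_diff X i (z : cycles X i) j : diff X i j (val z) = 0.
Proof.
have [ij|/diff_shape->//] := pselect (i = j + 1).
by apply: diff_eqj (kernelP z); rewrite ij addrK.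
Qed.

Lemma hclass_surj X i (c : homology X i) : exists z, hclass z = c.
Proof. exact: to_coker_surj. Qed.

Lemma hclass_eq0 X i (z : cycles X i) :
  hclass z = 0 <-> exists x, diff X (i + 1) i x = val z.
Proof.
split=> [/to_coker_eq0[x xz]|[x xz]]; first by exists x; rewrite -xz.
by apply/to_coker_eq0; exists x; apply: val_inj.
Qed.

Definition mk_cycle X i (x : X i) (xd : diff X i (i - 1) x = 0) : cycles X i :=
  to_kernel xd.

Section Map.
Variables (X Y : complex A) (f : chain_map X Y) (i : int).

Lemma cycle_map_subproof (z : cycles X i) : diff Y i (i - 1) (f i (val z)) = 0.
Proof. by rewrite -chain_diff cycle_diff linear0. Qed.

Definition cycle_map (z : cycles X i) : homology Y i :=
  hclass (mk_cycle (cycle_map_subproof z)).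
Lemma cycle_map_linear : linear cycle_map.
Proof.
move=> a x y; rewrite /cycle_map -linearP; congr hclass.
by apply: val_inj; rewrite /= !linearP.
Qed.
HB.instance Definition _ :=
  GRing.isLinear.Build A (cycles X i) (homology Y i) *:%R cycle_map cycle_map_linear.

Lemma cycle_map_boundary x : cycle_map (boundary x) = 0.
Proof. by apply/hclass_eq0; exists (f (i + 1) x); rewrite /= chain_diff. Qed.

Definition homology_map (c : homology X i) : homology Y i :=
  coker_lift cycle_map_boundary c.
Lemma homology_map_linear : linear homology_map.
Proof. exact: linearP. Qed.
HB.instance Definition _ := GRing.isLinear.Build A (homology X i) (homology Y i)
  *:%R homology_map homology_map_linear.

Lemma homology_mapE z : homology_map (hclass z) = cycle_map z.
Proof. exact: coker_liftE. Qed.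
End Map.

(* The connecting homomorphism of a degreewise short exact sequence of
   complexes 0 -> X -> Y -> Z -> 0; [snake] is its graph. *)
Section Snake.
Variables (X Y Z : complex A) (f : chain_map X Y) (g : chain_map Y Z).
Hypothesis finj : forall i, injective (f i).
Hypothesis fg : forall i y, g i y = 0 <-> exists x, f i x = y.
Hypothesis gsurj : forall i z, exists y, g i y = z.
Variable i : int.

Definition snake (c : homology Z (i + 1)) (a : homology X i) :=
  exists (z : cycles Z (i + 1)) (y : Y (i + 1)) (x : cycles X i),
    [/\ c = hclass z, a = hclass x, g (i + 1) y = val z &
        f i (val x) = diff Y (i + 1) i y].

Lemma snake_ex : exists delta : {linear homology Z (i + 1) -> homology X i},
  forall c a, snake c a <-> delta c = a.
Proof.
apply: linear_of_rel => [c|b c a c' a'|a].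
- have [z <-] := hclass_surj c; have [y yz] := gsurj (val z).
  have /fg[x xy] : g i (diff Y (i + 1) i y) = 0.
    by rewrite chain_diff yz cycle_diff.
  have dx : diff X i (i - 1) x = 0.
    by apply: (@finj (i - 1)); rewrite chain_diff xy diff_diff linear0.
  by exists (hclass (mk_cycle dx)), z, y, (mk_cycle dx).
- move=> [z [y [x [-> -> yz xy]]]] [z' [y' [x' [-> -> yz' xy']]]].
  exists (b *: z + z'), (b *: y + y'), (b *: x + x').
  by rewrite -!linearP; split=> //; rewrite !linearP ?yz ?yz' ?xy ?xy'.
- move=> [z [y [x [/esym/hclass_eq0[z' z'z] -> yz xy]]]].
  have [y' y'z'] := gsurj z'.
  have /fg[x' x'y] : g (i + 1) (y - diff Y (i + 1 + 1) (i + 1) y') = 0.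
    by rewrite linearB/= chain_diff y'z' z'z yz subrr.
  apply/hclass_eq0; exists x'; apply: (@finj i).
  by rewrite chain_diff x'y linearB/= diff_diff subr0 xy.
Qed.

Definition connecting : {linear homology Z (i + 1) -> homology X i} :=
  projT1 (cid snake_ex).

Lemma connectingP c a : snake c a <-> connecting c = a.
Proof. by rewrite /connecting; case: cid. Qed.

End Snake.
End HomologyTheory.

(* Associative unital k-algebras. MathComp's [algType] is not used because it
   excludes the zero ring. *)
Record algebra (k : comPzRingType) := MkAlgebra {
  alg_ring :> pzRingType;
  alg_map : {rmorphism k -> alg_ring};
  alg_central : forall a r, alg_map a * r = r * alg_map a }.

(* Right R-modules are [lmodType R^c], with m . r written [(r : R^c) *: m].
   The tensor product over R is the abelian group presented by the generators
   [TPure m n] and the bilinearity and balancing relations. *)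
Section Tensor.
Variables (k : comPzRingType) (R : algebra k) (M : lmodType R^c) (N : lmodType R).

Inductive tens_expr :=
| TZero
| TPure of M & N
| TOpp of tens_expr
| TAdd of tens_expr & tens_expr.

Inductive tens_eq : tens_expr -> tens_expr -> Prop :=
| teq_refl u : tens_eq u u
| teq_sym u v : tens_eq u v -> tens_eq v u
| teq_trans u v w : tens_eq u v -> tens_eq v w -> tens_eq u w
| teq_opp u v : tens_eq u v -> tens_eq (TOpp u) (TOpp v)
| teq_add u u' v v' :
    tens_eq u u' -> tens_eq v v' -> tens_eq (TAdd u v) (TAdd u' v')
| teq_addA u v w : tens_eq (TAdd u (TAdd v w)) (TAdd (TAdd u v) w)
| teq_addC u v : tens_eq (TAdd u v) (TAdd v u)
| teq_add0 u : tens_eq (TAdd TZero u) u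
| teq_addN u : tens_eq (TAdd (TOpp u) u) TZero
| teq_pureDl m m' n : tens_eq (TPure (m + m') n) (TAdd (TPure m n) (TPure m' n))
| teq_pureDr m n n' : tens_eq (TPure m (n + n')) (TAdd (TPure m n) (TPure m n'))
| teq_pureZ m (r : R) n : tens_eq (TPure ((r : R^c) *: m) n) (TPure m (r *: n)).

HB.instance Definition _ := gen_eqMixin tens_expr.
HB.instance Definition _ := gen_choiceMixin tens_expr.

Definition tens_eqb (u v : tens_expr) := `[< tens_eq u v >].
Lemma tens_eqb_equiv : equiv_class_of tens_eqb.
Proof.
split=> [u|u v|v u w]; first exact/asboolP/teq_refl.
- by apply/asboolP/asboolP; apply: teq_sym.
- by move=> /asboolP uv /asboolP vw; apply/asboolP/teq_trans/vw.
Qed.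
Canonical tens_equiv := EquivRelPack tens_eqb_equiv.
Canonical tens_encModRel := defaultEncModRel tens_eqb.

Definition tensor := {eq_quot tens_eqb}.
HB.instance Definition _ := Choice.on tensor.
HB.instance Definition _ := EqQuotient.on tensor.

Definition tclass (u : tens_expr) : tensor := \pi_tensor u.

Lemma tclassP u v : tclass u = tclass v <-> tens_eq u v.
Proof.
split=> [/eqmodP/asboolP//|uv]; apply/eqmodP; exact/asboolP.
Qed.

Lemma trepr u : tens_eq (repr (tclass u)) u.
Proof. by apply/tclassP; exact: reprK. Qed.

Lemma tclass_surj x : exists u, tclass u = x.
Proof. by exists (repr x); exact: reprK. Qed.

Definition tens_add (x y : tensor) := tclass (TAdd (repr x) (repr y)).
Definition tens_opp (x : tensor) := tclass (TOpp (repr x)).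

Lemma tens_addE u v : tens_add (tclass u) (tclass v) = tclass (TAdd u v).
Proof. by apply/tclassP/teq_add; apply: trepr. Qed.
Lemma tens_oppE u : tens_opp (tclass u) = tclass (TOpp u).
Proof. by apply/tclassP/teq_opp/trepr. Qed.

Lemma tens_addA : associative tens_add.
Proof.
move=> x y z; have [u <-] := tclass_surj x; have [v <-] := tclass_surj y.
by have [w <-] := tclass_surj z; rewrite !tens_addE; apply/tclassP/teq_addA.
Qed.
Lemma tens_addC : commutative tens_add.
Proof.
move=> x y; have [u <-] := tclass_surj x; have [v <-] := tclass_surj y.
by rewrite !tens_addE; apply/tclassP/teq_addC.
Qed.
Lemma tens_add0 : left_id (tclass TZero) tens_add.
Proof.
move=> x; have [u <-] := tclass_surj x.
by rewrite !tens_addE; apply/tclassP/teq_add0.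
Qed.
Lemma tens_addN : left_inverse (tclass TZero) tens_opp tens_add.
Proof.
move=> x; have [u <-] := tclass_surj x.
by rewrite tens_oppE !tens_addE; apply/tclassP/teq_addN.
Qed.
HB.instance Definition _ :=
  GRing.isZmodule.Build tensor tens_addA tens_addC tens_add0 tens_addN.

Definition pure (m : M) (n : N) : tensor := tclass (TPure m n).

Lemma pureDl m m' n : pure (m + m') n = pure m n + pure m' n.
Proof. by rewrite /pure [RHS]tens_addE; apply/tclassP/teq_pureDl. Qed.
Lemma pureDr m n n' : pure m (n + n') = pure m n + pure m n'.
Proof. by rewrite /pure [RHS]tens_addE; apply/tclassP/teq_pureDr. Qed.
Lemma pureZ m (r : R) n : pure ((r : R^c) *: m) n = pure m (r *: n).
Proof. exact/tclassP/teq_pureZ. Qed.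

Section ZLift.
Variables (W : zmodType) (b : M -> N -> W).
Hypothesis bDl : forall m m' n, b (m + m') n = b m n + b m' n.
Hypothesis bDr : forall m n n', b m (n + n') = b m n + b m n'.
Hypothesis bZ : forall m (r : R) n, b ((r : R^c) *: m) n = b m (r *: n).

Fixpoint expr_lift (u : tens_expr) : W :=
  match u with
  | TZero => 0
  | TPure m n => b m n
  | TOpp u => - expr_lift u
  | TAdd u v => expr_lift u + expr_lift v
  end.

Lemma expr_lift_eq u v : tens_eq u v -> expr_lift u = expr_lift v.
Proof.
elim=> {u v} /= [u|u v _ ->|u v w _ -> _ ->|u v _ ->|u u' v v' _ -> _ ->|
  u v w|u v|u|u|m m' n|m n n'|m r n] //.
- exact: addrA.
- exact: addrC.
- exact: add0r.
- exact: addNr.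
Qed.

Definition tens_zlift (x : tensor) : W := expr_lift (repr x).

Lemma tens_zliftE u : tens_zlift (tclass u) = expr_lift u.
Proof. exact/expr_lift_eq/trepr. Qed.
Lemma tens_zlift_pure m n : tens_zlift (pure m n) = b m n.
Proof. exact: tens_zliftE. Qed.
Lemma tens_zliftD x y : tens_zlift (x + y) = tens_zlift x + tens_zlift y.
Proof.
have [u <-] := tclass_surj x; have [v <-] := tclass_surj y.
by rewrite [_ + _]tens_addE !tens_zliftE.
Qed.
End ZLift.

Lemma tens_ind (P : tensor -> Prop) :
  P 0 -> (forall m n, P (pure m n)) -> (forall x, P x -> P (- x)) ->
  (forall x y, P x -> P y -> P (x + y)) -> forall x, P x.
Proof.
move=> P0 Pp PN PD x; have [u <-] := tclass_surj x.
elim: u => [|m n|u Pu|u Pu v Pv]; [exact: P0|exact: Pp| |].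
  by rewrite -tens_oppE; apply: PN.
by rewrite -tens_addE; apply: PD.
Qed.

Definition tens_scale (a : k) : tensor -> tensor :=
  tens_zlift (fun m n => pure m (alg_map R a *: n)).

Lemma tens_scale_pure a m n : tens_scale a (pure m n) = pure m (alg_map R a *: n).
Proof.
apply: tens_zlift_pure => [m1 m2 n1|m1 n1 n2|m1 r n1]; first exact: pureDl.
  by rewrite scalerDr pureDr.
by rewrite pureZ !scalerA alg_central.
Qed.
Lemma tens_scaleDr : right_distributive tens_scale +%R.
Proof.
move=> a x y.
apply: tens_zliftD => [m1 m2 n1|m1 n1 n2|m1 r n1]; first exact: pureDl.
  by rewrite scalerDr pureDr.
by rewrite pureZ !scalerA alg_central.
Qed.
Lemma tens_scale0r a : tens_scale a 0 = 0.
Proof. by apply: (addIr (tens_scale a 0)); rewrite -tens_scaleDr !add0r. Qed.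
Lemma tens_scaleN a x : tens_scale a (- x) = - tens_scale a x.
Proof.
by apply: (addIr (tens_scale a x)); rewrite -tens_scaleDr !addNr tens_scale0r.
Qed.
Lemma tens_scaleA a b x : tens_scale a (tens_scale b x) = tens_scale (a * b) x.
Proof.
elim/tens_ind: x => [|m n|x IH|x y IHx IHy].
- by rewrite !tens_scale0r.
- by rewrite !tens_scale_pure scalerA rmorphM.
- by rewrite !tens_scaleN IH.
- by rewrite !tens_scaleDr IHx IHy.
Qed.
Lemma tens_scale1 : left_id 1 tens_scale.
Proof.
elim/tens_ind => [|m n|x IH|x y IHx IHy].
- by rewrite tens_scale0r.
- by rewrite tens_scale_pure rmorph1 scale1r.
- by rewrite tens_scaleN IH.
- by rewrite tens_scaleDr IHx IHy.
Qed.
Lemma tens_scaleDl x : {morph tens_scale^~ x : a b / a + b}.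
Proof.
move=> a b; elim/tens_ind: x => [|m n|x IH|x y IHx IHy].
- by rewrite !tens_scale0r add0r.
- by rewrite !tens_scale_pure rmorphD scalerDl pureDr.
- by rewrite !tens_scaleN IH opprD.
- by rewrite !tens_scaleDr IHx IHy addrACA.
Qed.
HB.instance Definition _ := GRing.Zmodule_isLmodule.Build k tensor
  tens_scaleA tens_scale1 tens_scaleDr tens_scaleDl.

Lemma pure_scale a m n : a *: pure m n = pure m (alg_map R a *: n).
Proof. exact: tens_scale_pure. Qed.

End Tensor.

Section TensorMap.
Variables (k : comPzRingType) (R : algebra k).
Variables (M M' : lmodType R^c) (N N' : lmodType R).
Variables (f : {linear M -> M'}) (g : {linear N -> N'}).

Definition tmap : tensor M N -> tensor M' N' :=
  tens_zlift (fun m n => pure (f m) (g n)).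

Lemma tmap_pure m n : tmap (pure m n) = pure (f m) (g n).
Proof.
apply: tens_zlift_pure => [m1 m2 n1|m1 n1 n2|m1 r n1].
- by rewrite linearD pureDl.
- by rewrite linearD pureDr.
- by rewrite !linearZ/= pureZ.
Qed.
Lemma tmap_nmod : zmod_morphism tmap.
Proof.
have tD x y : tmap (x + y) = tmap x + tmap y.
  apply: tens_zliftD => [m1 m2 n1|m1 n1 n2|m1 r n1].
  - by rewrite linearD pureDl.
  - by rewrite linearD pureDr.
  - by rewrite !linearZ/= pureZ.
by move=> x y; apply: (addIr (tmap y)); rewrite -tD !subrK.
Qed.
HB.instance Definition _ :=
  GRing.isZmodMorphism.Build (tensor M N) (tensor M' N') tmap tmap_nmod.
Lemma tmap_scalable : scalable tmap.
Proof.
move=> a; elim/tens_ind => [|m n|x IH|x y IHx IHy].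
- by rewrite scaler0 raddf0 scaler0.
- by rewrite pure_scale !tmap_pure pure_scale !linearZ.
- by rewrite !raddfN/= IH.
- by rewrite !raddfD/= IHx IHy.
Qed.
HB.instance Definition _ := GRing.isScalable.Build k
  (tensor M N) (tensor M' N') *:%R tmap tmap_scalable.
End TensorMap.

Section Modules.
Variable A : pzRingType.
Implicit Types U V W : lmodType A.

Definition onto U V (f : {linear U -> V}) := forall v, exists u, f u = v.

Definition exact_pair U V W (f : {linear U -> V}) (g : {linear V -> W}) :=
  forall v, g v = 0 <-> exists u, f u = v.

Definition isomorphic U V := exists f : {linear U -> V}, bijective f.

Definition projective_mod (P : lmodType A) :=
  forall U V (p : {linear U -> V}) (h : {linear P -> V}), onto p ->
  exists h' : {linear P -> U}, forall x, p (h' x) = h x.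

Definition injective_mod (E : lmodType A) :=
  forall U V (j : {linear U -> V}) (h : {linear U -> E}), injective j ->
  exists h' : {linear V -> E}, forall x, h' (j x) = h x.

Record ses := Ses {
  ses_l : lmodType A;
  ses_m : lmodType A;
  ses_r : lmodType A;
  ses_f : {linear ses_l -> ses_m};
  ses_g : {linear ses_m -> ses_r};
  ses_inj : injective ses_f;
  ses_exact : exact_pair ses_f ses_g;
  ses_surj : onto ses_g }.

Record ses_map (s t : ses) := SesMap {
  smap_l : {linear ses_l s -> ses_l t};
  smap_m : {linear ses_m s -> ses_m t};
  smap_r : {linear ses_r s -> ses_r t};
  smap_f : forall x, smap_m (ses_f s x) = ses_f t (smap_l x);
  smap_g : forall x, smap_r (ses_g s x) = ses_g t (smap_m x) }.

End Modules.

Section Exactness.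
Variables (k : comPzRingType) (R : algebra k).

Definition flat_mod (M : lmodType R^c) :=
  forall (N N' : lmodType R) (g : {linear N -> N'}),
  injective g -> injective (tmap (idfun : {linear M -> M}) g).

Lemma tmap_idfun (M : lmodType R^c) (N : lmodType R) x :
  tmap (idfun : {linear M -> M}) (idfun : {linear N -> N}) x = x.
Proof.
elim/tens_ind: x => [|m n|x IH|x y IHx IHy].
- by rewrite raddf0.
- by rewrite tmap_pure.
- by rewrite raddfN/= IH.
- by rewrite raddfD/= IHx IHy.
Qed.

Lemma tmap_comp (M M' M'' : lmodType R^c) (N N' N'' : lmodType R)
    (f : {linear M -> M'}) (f' : {linear M' -> M''}) (f'' : {linear M -> M''})
    (g : {linear N -> N'}) (g' : {linear N' -> N''}) (g'' : {linear N -> N''}) :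
  (forall x, f' (f x) = f'' x) -> (forall x, g' (g x) = g'' x) ->
  forall x, tmap f' g' (tmap f g x) = tmap f'' g'' x.
Proof.
move=> ff gg; elim/tens_ind => [|m n|x IH|x y IHx IHy].
- by rewrite !raddf0.
- by rewrite !tmap_pure ff gg.
- by rewrite !raddfN/= IH.
- by rewrite !raddfD/= IHx IHy.
Qed.

Lemma tmap0 (M M' : lmodType R^c) (N N' : lmodType R)
    (f : {linear M -> M'}) (g : {linear N -> N'}) :
  (forall x, f x = 0) \/ (forall x, g x = 0) -> forall x, tmap f g x = 0.
Proof.
move=> fg; elim/tens_ind => [|m n|x IH|x y IHx IHy].
- by rewrite raddf0.
- rewrite tmap_pure; case: fg => ->.
    by apply: (addIr (pure 0 (g n))); rewrite -pureDl !add0r.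
  by apply: (addIr (pure (f m) 0)); rewrite -pureDr !add0r.
- by rewrite raddfN/= IH oppr0.
- by rewrite raddfD/= IHx IHy addr0.
Qed.

Lemma tmap_surj (M : lmodType R^c) (N N' : lmodType R) (g : {linear N -> N'}) :
  onto g -> onto (tmap (idfun : {linear M -> M}) g).
Proof.
move=> gs; elim/tens_ind => [|m n|x [y <-]|x y [x' <-] [y' <-]].
- by exists 0; rewrite raddf0.
- by have [n' <-] := gs n; exists (pure m n'); exact: tmap_pure.
- by exists (- y); rewrite raddfN.
- by exists (x' + y'); rewrite raddfD.
Qed.

Lemma pure_oppr (M : lmodType R^c) (N : lmodType R) (m : M) (n n' : N) :
  pure m (n - n') = pure m n - pure m n'.
Proof. by apply: (addIr (pure m n')); rewrite -pureDr !subrK. Qed.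

Lemma tmap_exact (M : lmodType R^c) (N N' N'' : lmodType R)
    (f : {linear N -> N'}) (g : {linear N' -> N''}) :
  exact_pair f g -> onto g ->
  exact_pair (tmap (idfun : {linear M -> M}) f) (tmap (idfun : {linear M -> M}) g).
Proof.
move=> fg gs x; split=> [gx|[y <-]]; last first.
  rewrite /= (tmap_comp (f'' := idfun) (g'' := \0)) //.
    by apply: tmap0; right.
  by move=> z; apply/fg; exists z.
pose F := tmap (idfun : {linear M -> M}) f.
pose s n := projT1 (cid (gs n)).
have gK n : g (s n) = n by rewrite /s; case: cid.
pose b (m : M) n : cokernel F := to_coker F (pure m (s n)).
have bE m n n' : g n = n' -> b m n' = to_coker F (pure m n).
  move=> gn; apply/to_coker_eq; rewrite -pure_oppr.
  have /fg[u fu] : g (s n' - n) = 0 by rewrite linearB/= gK gn subrr.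
  by exists (pure m u); rewrite -fu; exact: tmap_pure.
have bDl m m' n : b (m + m') n = b m n + b m' n by rewrite /b pureDl linearD.
have bDr m n n' : b m (n + n') = b m n + b m n'.
  by rewrite (bE _ (s n + s n')) ?linearD/= ?gK// pureDr linearD.
have bZ m (r : R) n : b ((r : R^c) *: m) n = b m (r *: n).
  by rewrite [RHS](bE _ (r *: s n)) ?linearZ/= ?gK// -pureZ.
have hE y : tens_zlift b (tmap (idfun : {linear M -> M}) g y) = to_coker F y.
  have hD := tens_zliftD bDl bDr bZ.
  have h0 : tens_zlift b 0 = 0.
    by apply: (addIr (tens_zlift b 0)); rewrite -hD !add0r.
  elim/tens_ind: y => [|m n|y IH|y z IHy IHz].
  - by rewrite !raddf0.
  - by rewrite tmap_pure tens_zlift_pure//; apply: bE.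
  - rewrite !raddfN/= -IH; apply: (addIr (tens_zlift b (tmap idfun g y))).
    by rewrite -hD !addNr.
  - by rewrite !raddfD/= hD IHy IHz.
have /to_coker_eq0[y] : to_coker F x = 0.
  rewrite -hE gx; apply: (addIr (tens_zlift b 0)).
  by rewrite -(tens_zliftD bDl bDr bZ) !add0r.
by exists y.
Qed.

End Exactness.

(* The functions P -> A with finite support, that is, the free A-module on the
   underlying set of P; used only to prove that projective modules are flat. *)
Section FreeModule.
Variables (A : pzRingType) (P : lmodType A).

Definition finsupp_pred : {pred (P -> A^o)} :=
  fun f => `[< exists s : seq P, forall p, p \notin s -> f p = 0 >].
Lemma finsupp_closed : submod_closed finsupp_pred.
Proof.
split=> [|a f g]; first by apply/asboolP; exists [::].
move=> /asboolP[s fs] /asboolP[t gt]; apply/asboolP; exists (s ++ t) => p.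
rewrite mem_cat negb_or => /andP[/fs fp /gt gp].
have -> : (a *: f + g) p = a *: f p + g p by [].
by rewrite fp gp scaler0; exact: addr0.
Qed.
HB.instance Definition _ :=
  GRing.isSubmodClosed.Build A (P -> A^o) finsupp_pred finsupp_closed.

Definition free_mod := {f : P -> A^o | finsupp_pred f}.
HB.instance Definition _ := SubChoice.on free_mod.
HB.instance Definition _ := [SubChoice_isSubLmodule of free_mod by <:].

Definition carries (s : seq P) (f : free_mod) :=
  uniq s /\ forall p, p \notin s -> val f p = 0.

Lemma carries_ex (f : free_mod) : exists s, carries s f.
Proof.
have /asboolP[s fs] := valP f; exists (undup s); split=> [|p].
  exact: undup_uniq.
by rewrite mem_undup => /fs.
Qed.

Definition esum (s : seq P) (f : free_mod) : P := \sum_(p <- s) (val f p : A) *: p.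

Lemma esum_carries s t f : carries s f -> carries t f -> esum s f = esum t f.
Proof.
have E (u : seq P) : esum u f = \sum_(p <- [seq p <- u | val f p != 0]) (val f p : A) *: p.
  rewrite big_filter /esum [RHS]big_mkcond; apply: eq_bigr => p _.
  by case: eqP => [->|//]; rewrite scale0r.
move=> [us fs] [ut ft]; rewrite !E; apply: perm_big; apply: uniq_perm.
- exact: filter_uniq.
- exact: filter_uniq.
move=> p; rewrite !mem_filter; case: eqP => //= fp.
by apply/idP/idP => _; apply/negPn/negP; [move=> /ft|move=> /fs].
Qed.

Definition free_ev (f : free_mod) : P := esum (projT1 (cid (carries_ex f))) f.

Lemma free_evE s f : carries s f -> free_ev f = esum s f.
Proof. by apply: esum_carries; case: cid. Qed.

Lemma carries_cat (s t : seq P) f : carries s f -> carries (undup (s ++ t)) f.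
Proof.
move=> [_ fs]; split=> [|p]; first exact: undup_uniq.
by rewrite mem_undup mem_cat negb_or => /andP[/fs].
Qed.

Lemma carries_catr (s t : seq P) f : carries t f -> carries (undup (s ++ t)) f.
Proof.
move=> [_ ft]; split=> [|p]; first exact: undup_uniq.
by rewrite mem_undup mem_cat negb_or => /andP[_ /ft].
Qed.

Lemma free_ev_linear : linear free_ev.
Proof.
move=> a f g; have [s sf] := carries_ex f; have [t tg] := carries_ex g.
have cf := carries_cat t sf; have cg := carries_catr s tg.
have cfg : carries (undup (s ++ t)) (a *: f + g).
  split=> [|p pst]; first by case: cf.
  rewrite [LHS]/(a *: val f p + val g p).
  by rewrite (proj2 cf)// (proj2 cg)// scaler0; exact: addr0.
rewrite (free_evE cf) (free_evE cg) (free_evE cfg) /esum.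
rewrite scaler_sumr -big_split/=; apply: eq_bigr => p _.
by rewrite scalerA -scalerDl.
Qed.
HB.instance Definition _ :=
  GRing.isLinear.Build A free_mod P *:%R free_ev free_ev_linear.

Lemma delta_finsupp (p : P) : finsupp_pred (fun q => ((q == p)%:R : A^o)).
Proof. by apply/asboolP; exists [:: p] => q; rewrite inE => /negPf ->. Qed.

Lemma free_ev_surj : onto (free_ev : {linear free_mod -> P}).
Proof.
move=> p; pose d : free_mod :=
  exist finsupp_pred (fun q => ((q == p)%:R : A^o)) (delta_finsupp p); exists d.
have cd : carries [:: p] d.
  by split=> // q; rewrite inE /= => /negPf ->.
by rewrite /= (free_evE cd) /esum big_seq1/= eqxx scale1r.
Qed.

Lemma dual_basis : projective_mod P ->
  exists phi : P -> {linear P -> A^o}, forall x, exists s : seq P,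
    (uniq s /\ forall t, uniq t -> {subset s <= t} ->
       x = \sum_(p <- t) (phi p x : A) *: p).
Proof.
move=> projP.
have [h hE] := projP free_mod P free_ev (idfun : {linear P -> P}) free_ev_surj.
have lin p : linear (fun x => val (h x) p : A^o).
  by move=> a x y; rewrite linearP.
pose phi p : {linear P -> A^o} := HB.pack (fun x => val (h x) p : A^o)
  (GRing.isLinear.Build _ _ _ _ _ (lin p)).
exists phi => x; have [s [us sx]] := carries_ex (h x); exists s; split=> // t ut st.
have ct : carries t (h x).
  by split=> // p pt; apply: sx; apply: contra pt; exact: st.
by rewrite -[LHS]/(idfun x) -hE /= (free_evE ct).
Qed.

End FreeModule.

Section ProjectiveFlat.
Variables (k : comPzRingType) (R : algebra k) (P : lmodType R^c).
Hypothesis projP : projective_mod P.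

Lemma projective_flat : flat_mod P.
Proof.
move=> N N' g ginj.
have [phi phiE] := dual_basis projP.
pose b (L : lmodType R) p (m : P) (n : L) : L := (phi p m : R) *: n.
have bDl L p m m' n : b L p (m + m') n = b L p m n + b L p m' n.
  by rewrite /b linearD scalerDl.
have bDr L p m n n' : b L p m (n + n') = b L p m n + b L p m n'.
  by rewrite /b scalerDr.
have bZ L p m (r : R) n : b L p ((r : R^c) *: m) n = b L p m (r *: n).
  by rewrite /b linearZ/= scalerA.
pose e L p (x : tensor P L) : L := tens_zlift (b L p) x.
have eD L p x y : e L p (x + y) = e L p x + e L p y.
  exact: tens_zliftD (bDl L p) (bDr L p) (bZ L p) x y.
have eP L p m n : e L p (pure m n) = b L p m n.
  exact: tens_zlift_pure (bDl L p) (bDr L p) (bZ L p) m n.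
have e0 L p : e L p 0 = 0 by apply: (addIr (e L p 0)); rewrite -eD !add0r.
have eN L p x : e L p (- x) = - e L p x.
  by apply: (addIr (e L p x)); rewrite -eD !addNr e0.
have eg p x : e N' p (tmap (idfun : {linear P -> P}) g x) = g (e N p x).
  elim/tens_ind: x => [|m n|x IH|x y IHx IHy].
  - by rewrite raddf0 !e0 raddf0.
  - by rewrite tmap_pure !eP /b linearZ.
  - by rewrite raddfN/= !eN IH raddfN.
  - by rewrite raddfD/= !eD IHx IHy raddfD.
have pure0 (m : P) : pure m (0 : N) = 0.
  by apply: (addIr (pure m 0)); rewrite -pureDr !add0r.
have pure_sum (s : seq P) (F : P -> P) (n : N) :
    pure (\sum_(p <- s) F p) n = \sum_(p <- s) pure (F p) n.
  apply: (big_morph (fun m => pure m n)) => [x y|]; first exact: pureDl.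
  by apply: (addIr (pure 0 n)); rewrite -pureDl !add0r.
have expand x : exists s : seq P, forall t, uniq t -> {subset s <= t} ->
    x = \sum_(p <- t) pure p (e N p x).
  elim/tens_ind: x => [|m n|x [s IH]|x y [s IHx] [s' IHy]].
  - by exists [::] => t _ _; rewrite big1// => p _; rewrite e0 pure0.
  - have [s [_ sE]] := phiE m; exists s => t ut st.
    rewrite {1}(sE t ut st) pure_sum; apply: eq_bigr => p _.
    by rewrite pureZ eP.
  - exists s => t ut st; rewrite {1}(IH t ut st) -sumrN; apply: eq_bigr => p _.
    by rewrite eN; apply: (addIr (pure p (e N p x))); rewrite -pureDr !addNr pure0.
  - exists (s ++ s') => t ut st.
    have sst : {subset s <= t} by move=> p ps; apply: st; rewrite mem_cat ps.
    have s't : {subset s' <= t}.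
      by move=> p ps; apply: st; rewrite mem_cat ps orbT.
    rewrite {1}(IHx t ut sst) {1}(IHy t ut s't) -big_split.
    by apply: eq_bigr => p _; rewrite eD pureDr.
suff ker0 x : tmap (idfun : {linear P -> P}) g x = 0 -> x = 0.
  move=> x y gxy; apply/eqP; rewrite -subr_eq0; apply/eqP; apply: ker0.
  by rewrite raddfB/= gxy subrr.
move=> gx; have [s /(_ _ (undup_uniq s))->] := expand x; last first.
  by move=> p; rewrite mem_undup.
apply: big1 => p _; suff -> : e N p x = 0 by exact: pure0.
by apply: ginj; rewrite -eg gx e0 raddf0.
Qed.

End ProjectiveFlat.

Section Gorenstein.
Variable A : pzRingType.

(* The last clause is the acyclicity of the complex Hom(T, P), spelled out at
   Hom(T_i, P). *)
Definition totally_acyclic (T : complex A) :=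
  [/\ forall i, projective_mod (T i), acyclic T &
      forall P : lmodType A, projective_mod P ->
      forall i (phi : {linear T i -> P}),
        (forall x, phi (diff T (i + 1) i x) = 0) ->
        exists psi : {linear T (i - 1) -> P},
          forall x, phi x = psi (diff T i (i - 1) x)].

Definition gorenstein_projective (G : lmodType A) :=
  exists T : complex A,
    totally_acyclic T /\ isomorphic (cokernel (diff T 1 0)) G.

Record proj_resolution (M : lmodType A) := ProjResolution {
  pres_cpx :> complex A;
  pres_aug : {linear pres_cpx 0 -> M};
  pres_proj : forall i, projective_mod (pres_cpx i);
  pres_neg : forall i (x : pres_cpx i), i < 0 -> x = 0;
  pres_exact : forall i, 0 < i ->
    exact_pair (diff pres_cpx (i + 1) i) (diff pres_cpx i (i - 1));
  pres_exact0 : exact_pair (diff pres_cpx 1 0) pres_aug;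
  pres_surj : onto pres_aug }.

Record complete_resolution (M : lmodType A) := CompleteResolution {
  cres_tate : complex A;
  cres_proj : proj_resolution M;
  cres_map : chain_map cres_tate cres_proj;
  cres_tac : totally_acyclic cres_tate;
  cres_iso : exists n : int, forall i, n <= i -> bijective (cres_map i) }.

End Gorenstein.

Section TensorComplex.
Variables (k : comPzRingType) (R : algebra k) (X : complex R^c).

Section Obj.
Variable N : lmodType R.

Definition tens_diff i j : {linear tensor (X i) N -> tensor (X j) N} :=
  tmap (diff X i j) (idfun : {linear N -> N}).

Lemma tens_diff_shape i j x : i <> j + 1 -> tens_diff i j x = 0.
Proof. by move=> ij; apply: tmap0; left=> y; exact: diff_shape. Qed.

Lemma tens_diff_diff i j l x : tens_diff j l (tens_diff i j x) = 0.
Proof.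
rewrite /tens_diff /= (tmap_comp (f'' := \0) (g'' := idfun)) //.
  by apply: tmap0; left.
exact: diff_diff.
Qed.

Definition tens_cpx : complex k := Complex tens_diff_shape tens_diff_diff.
End Obj.

Section Map.
Variables (N N' : lmodType R) (g : {linear N -> N'}).

Definition tens_cpx_fun i : {linear tens_cpx N i -> tens_cpx N' i} :=
  tmap (idfun : {linear X i -> X i}) g.

Lemma tens_cpx_diff i j x :
  tens_cpx_fun j (diff (tens_cpx N) i j x) = diff (tens_cpx N') i j (tens_cpx_fun i x).
Proof.
rewrite /tens_cpx_fun /= !(tmap_comp (f'' := diff X i j) (g'' := g)) //.
Qed.

Definition tens_cpx_map : chain_map (tens_cpx N) (tens_cpx N') :=
  ChainMap tens_cpx_diff.
End Map.
End TensorComplex.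

Definition gorenstein_flat (k : comPzRingType) (R : algebra k) (G : lmodType R^c) :=
  exists T : complex R^c,
    [/\ forall i, flat_mod (T i), acyclic T,
        isomorphic (cokernel (diff T 1 0)) G &
        forall E : lmodType R, injective_mod E -> acyclic (tens_cpx T E)].

Section Functors.
Variables (k : comPzRingType) (R : algebra k).

Record mod_functor := ModFunctor {
  fobj :> lmodType R -> lmodType k;
  fmap : forall M N : lmodType R, {linear M -> N} -> {linear fobj M -> fobj N};
  fmap_id : forall (M : lmodType R) x, fmap (idfun : {linear M -> M}) x = x;
  fmap_comp : forall (M N L : lmodType R) (f : {linear M -> N}) (g : {linear N -> L}) x,
    fmap (g \o f) x = fmap g (fmap f x) }.

Record nat_trans (F G : mod_functor) := NatTrans {
  ntrans :> forall N : lmodType R, {linear F N -> G N};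
  ntrans_nat : forall (M N : lmodType R) (f : {linear M -> N}) x,
    ntrans N (fmap F f x) = fmap G f (ntrans M x) }.

Definition functor_iso (F G : mod_functor) :=
  exists eta : nat_trans F G, forall N : lmodType R, bijective (eta N).

(* Families {F_i} of covariant functors come with natural connecting maps
   F_{i+1}(C) -> F_i(A) for the short exact sequences 0 -> A -> B -> C -> 0, and
   morphisms of families commute with them. Without this structure the degrees
   would be unrelated, and the coreflection below would reduce to the subfunctors
   Ker (T_i(N) -> T_i(E)), with N embedded in an injective module E; for
   T = Tor(M, -) these vanish in negative degrees. *)
Record functor_family := Family {
  fam_fun :> int -> mod_functor;
  conn : forall (s : ses R) i,
    {linear fam_fun (i + 1) (ses_r s) -> fam_fun i (ses_l s)};
  conn_nat : forall (s t : ses R) (h : ses_map s t) i x,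
    fmap (fam_fun i) (smap_l h) (conn s i x) =
    conn t i (fmap (fam_fun (i + 1)) (smap_r h) x) }.

Record family_map (U T : functor_family) := FamilyMap {
  fam_trans :> forall i, nat_trans (U i) (T i);
  fam_conn : forall (s : ses R) i x,
    fam_trans i (ses_l s) (conn U s i x) =
    conn T s i (fam_trans (i + 1) (ses_r s) x) }.

Definition long_exact (F : functor_family) (s : ses R) := forall i,
  [/\ exact_pair (fmap (F i) (ses_f s)) (fmap (F i) (ses_g s)),
      exact_pair (fmap (F (i + 1)) (ses_g s)) (conn F s i) &
      exact_pair (conn F s i) (fmap (F i) (ses_f s))].

(* Exactness is required only when the middle term is injective, where it amounts
   to U_{i+1}(C) ~ U_i(A). Requiring it of all short exact sequences would be too
   strong: the J-completion of Tor(M, -) is the limit over j of the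
   Tor_{i+j}(M, N^j), N^j being a j-th cosyzygy of N, and inverse limits do
   not preserve exactness. *)
Definition J_family (U : functor_family) :=
  (forall E : lmodType R, injective_mod E -> forall i (x : U i E), x = 0) /\
  (forall s, injective_mod (ses_m s) -> long_exact U s).

(* [tau] exhibits [C] as the J-completion of [T]; it is unique up to a unique
   isomorphism. *)
Definition J_completion (T C : functor_family) (tau : family_map C T) :=
  J_family C /\
  forall (U : functor_family) (ups : family_map U T), J_family U ->
    exists sigma : family_map U C,
      (forall i (N : lmodType R) x, tau i N (sigma i N x) = ups i N x) /\
      forall sigma' : family_map U C,
        (forall i (N : lmodType R) x, tau i N (sigma' i N x) = ups i N x) ->
        forall i (N : lmodType R) x, sigma' i N x = sigma i N x.

Section HomologyFunctor.
Variables (X : complex R^c) (i : int).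

Lemma homology_mapP (B C : complex k) (f : chain_map B C) (z : cycles B i)
    (w : cycles C i) :
  f i (val z) = val w -> homology_map f (hclass z) = hclass w.
Proof.
by move=> fz; rewrite homology_mapE /cycle_map; congr hclass; apply: val_inj.
Qed.

Definition hfun_obj (N : lmodType R) : lmodType k := homology (tens_cpx X N) i.

Definition hfun_map (M N : lmodType R) (f : {linear M -> N}) :
    {linear hfun_obj M -> hfun_obj N} :=
  @homology_map _ _ _ (tens_cpx_map X f) i.

Lemma hfun_id (M : lmodType R) x : hfun_map (idfun : {linear M -> M}) x = x.
Proof.
have [z <-] := hclass_surj x.
by apply: homology_mapP; rewrite /= tmap_idfun.
Qed.

Lemma hfun_comp (M N L : lmodType R) (f : {linear M -> N}) (g : {linear N -> L}) x :
  hfun_map (g \o f) x = hfun_map g (hfun_map f x).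
Proof.
have [z <-] := hclass_surj x.
rewrite /hfun_map /= [in RHS]homology_mapE /cycle_map; apply/esym.
rewrite (homology_mapE _ z); apply: homology_mapP.
by rewrite /= (tmap_comp (f'' := idfun) (g'' := g \o f)).
Qed.

Definition homology_functor : mod_functor := ModFunctor hfun_id hfun_comp.
End HomologyFunctor.

Section Tor.
Variables (M : lmodType R^c) (P : proj_resolution M).

Definition tor_fun i := homology_functor P i.

Section Connecting.
Variables (s : ses R) (i : int).

Let f := tens_cpx_map P (ses_f s).
Let g := tens_cpx_map P (ses_g s).

Lemma tor_inj j : injective (f j).
Proof. exact: (projective_flat (@pres_proj _ _ P j) (@ses_inj _ s)). Qed.
Lemma tor_exact j y : g j y = 0 <-> exists x, f j x = y.
Proof. exact: (@tmap_exact _ _ (P j) _ _ _ _ _ (@ses_exact _ s) (@ses_surj _ s) y). Qed.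
Lemma tor_surj j z : exists y, g j y = z.
Proof. exact: (@tmap_surj _ _ (P j) _ _ _ (@ses_surj _ s) z). Qed.

Definition tor_conn : {linear tor_fun (i + 1) (ses_r s) -> tor_fun i (ses_l s)} :=
  connecting tor_inj tor_exact tor_surj i.
End Connecting.

Lemma tor_conn_nat (s t : ses R) (h : ses_map s t) i x :
  fmap (tor_fun i) (smap_l h) (tor_conn s i x) =
  tor_conn t i (fmap (tor_fun (i + 1)) (smap_r h) x).
Proof.
apply/esym/connectingP.
have /connectingP[z [y [w [-> -> yz wy]]]] := erefl (tor_conn s i x).
have Ez := cycle_map_subproof (tens_cpx_map P (smap_r h)) z.
have Ew := cycle_map_subproof (tens_cpx_map P (smap_l h)) w.
exists (mk_cycle Ez), (tens_cpx_map P (smap_m h) (i + 1) y), (mk_cycle Ew); split.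
- exact: homology_mapP.
- exact: homology_mapP.
- rewrite /= -yz /= !(tmap_comp (f'' := idfun) (g'' := smap_r h \o ses_g s))//.
  by move=> u /=; rewrite smap_g.
- rewrite -[RHS]chain_diff -wy /=.
  rewrite !(tmap_comp (f'' := idfun) (g'' := smap_m h \o ses_f s))//.
  by move=> u /=; rewrite smap_f.
Qed.

Definition tor : functor_family := Family tor_conn_nat.
End Tor.

Definition tate_tor (M : lmodType R^c) (X : complete_resolution M) (i : int) :
  mod_functor := homology_functor (cres_tate X) i.

End Functors.

(* Main.v *)
(* Tensoring a totally acyclic complex T with N and taking homology gives a family of
   functors that agrees with Tor(M, N) in high degrees. Suppose that it vanishes on
   injective modules. A morphism from a J-family U to Tor then lifts to it: the lift is
   forced in high degrees, and the connecting maps of the sequences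
   0 -> N -> E -> N' -> 0 with E injective are bijective in both families, so
   it extends uniquely to lower degrees. Hence Tate homology is the J-completion of Tor.
   The vanishing on an injective module E says that T (x) E is acyclic. This holds when the
   cokernels in T are Gorenstein flat, since exactness of T (x) E in one degree is the
   vanishing of a Tor_1, which may be computed from any flat resolution of the cokernel.
   Conversely a totally acyclic complex is the Tate part of a complete resolution of
   its cokernel, and a family isomorphic to a J-family vanishes on injectives. *)
From HB Require Import structures.
From mathcomp Require Import all_boot all_order all_algebra.
From mathcomp Require Import boolp classical_sets functions zify.
Require Import Defs.

Set Implicit Arguments.
Unset Strict Implicit.
Unset Printing Implicit Defensive.

Import Order.TTheory GRing.Theory Num.Theory.
Local Open Scope ring_scope.
Local Open Scope quotient_scope.

(** * Enough injectives *)

Definition divisible (D : zmodType) :=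
  forall (d : nat) (x : D), (0 < d)%N -> exists y, y *+ d = x.

(** * Extension of additive maps into divisible groups *)

Section DivisibleInjective.
Local Open Scope classical_set_scope.
Variables (U V D : zmodType) (j : {additive U -> V}) (h : {additive U -> D}).
Hypothesis divD : divisible D.
Hypothesis jinj : injective j.

(** The graphs of partial homomorphisms from [V] to [D] that extend [h] along [j]. For a subgroup,
    the last clause is single-valuedness. *)
Let good (G : set (V * D)) := (forall u, G (j u, h u)) /\
  (forall p q, G p -> G q -> G (p - q)) /\ (forall y, G (0, y) -> y = 0).

Lemma good_mulz G (p : V * D) n : good G -> G p -> G (p *~ n).
Proof.
move=> [_ [GB _]] Gp.
have G0 : G 0 by rewrite -(subrr p); apply: GB.
have GN q : G q -> G (- q) by move=> Gq; rewrite -[- q]add0r; apply: GB.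
have GD q q' : G q -> G q' -> G (q + q').
  by move=> Gq Gq'; rewrite -[q']opprK; apply: GB => //; apply: GN.
have Gn m : G (p *+ m) by elim: m => [|m IH]; rewrite ?mulr0n// mulrS; apply: GD.
by case: n => n; [exact: Gn|apply: GN; exact: Gn].
Qed.

(* A generator of the ideal of the integers carrying [v] into the domain of [G]
   determines a value for [v] compatible with [G]. *)
Lemma good_value G v : good G ->
  exists e : D, forall n z, G (v *~ n, z) -> z = e *~ n.
Proof.
move=> gG; have [_ [GB Gf]] := gG.
have pairZ (a : V) (b : D) m : (a, b) *~ m = (a *~ m, b *~ m).
  have pairM (a' : V) (b' : D) i : (a', b') *+ i = (a' *+ i, b' *+ i).
    by elim: i => [|i IH] //; rewrite !mulrS IH.
  by case: m => m; rewrite /intmul pairM.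
(* If no positive multiple of [v] lies in the domain, only [n = 0] occurs and any value serves, here
   0. *)
have [[d0 [z0' [d0p Gd0]]]|none] :=
  pselect (exists d z, (0 < d)%N /\ G (v *+ d, z)); last first.
  exists 0 => n z Gz; rewrite mul0rz.
  have [n0|n0] := eqVneq n 0; first by move: Gz; rewrite n0 mulr0z => /Gf.
  exfalso; apply: none; exists `|n|%N, (z *~ sgz n); split.
    by rewrite absz_gt0.
  have := good_mulz (sgz n) gG Gz.
  by rewrite pairZ -mulrzA mulrC -abszEsg.
have ex : exists d, `[< (0 < d)%N /\ exists z, G (v *+ d, z) >].
  by exists d0; apply/asboolP; split=> //; exists z0'.
case: (ex_minnP ex) => d /asboolP[dp [z0 Gz0]] dmin.
have [e ed] := divD z0 dp; exists e => n z Gz.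
have := divz_eq n d; set q := (n %/ d)%Z; set r := (n %% d)%Z => nE.
have r0 : 0 <= r by apply: modz_ge0; rewrite eqz_nat -lt0n.
have rd : r < d by apply: ltz_pmod.
(* The remainder [r] also carries [v] into the domain and is smaller than the least positive such
   integer [d], hence is 0. *)
have Gr : G (v *~ r, z - z0 *~ q).
  have := GB _ _ Gz (good_mulz q gG Gz0); rewrite pairZ.
  suff -> : v *~ r = v *~ n - v *+ d *~ q by [].
  rewrite pmulrn -mulrzA [_ * q]mulrC -mulrzBr; congr (_ *~ _).
move: r r0 rd nE Gr => [r|//] _ rd nE Gr.
have [r0|r0] := posnP r; last first.
  suff /dmin : `[< (0 < r)%N /\ exists z, G (v *+ r, z) >] by rewrite leqNgt -ltz_nat rd.
  by apply/asboolP; split=> //; exists (z - z0 *~ q).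
move: Gr; rewrite r0 mulr0z => /Gf/eqP; rewrite subr_eq0 => /eqP->.
by rewrite nE r0 addr0 -ed mulrC mulrzA.
Qed.

(** Zorn's lemma gives a maximal good graph, and [good_value] would extend it to any element outside
    its domain. *)
Lemma divisible_injective : exists h' : {additive V -> D}, forall u, h' (j u) = h u.
Proof.
pose P (G : set (V * D)) := G = set0 \/ good G.
have [F FP Ftot|A [PA Amax]] := @Zorn_bigcup (V * D)%type P.
  have [[G0 [FG0 G0n]]|none] := pselect (exists G, F G /\ G !=set0).
  - have gF G : F G -> G !=set0 -> good G.
      by move=> /FP[->/set0P/eqP|].
    have F0 : good G0 by exact: gF.
    right; split; last split.
    + by move=> u; exists G0 => //; case: F0.
    + move=> p q [G FG Gp] [H FH Hq].
      have gG : good G by apply: gF => //; exists p.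
      have gH : good H by apply: gF => //; exists q.
      have [GH|HG] := Ftot _ _ FG FH.
      * by exists H => //; case: gH => _ [HB _]; apply: HB => //; apply: GH.
      * by exists G => //; case: gG => _ [GB _]; apply: GB => //; apply: HG.
    + move=> y [G FG Gy]; have [_ [_ Gf]] : good G by apply: gF => //; exists (0, y).
      exact: Gf.
  - left; rewrite -subset0 => p [G FG Gp].
    by apply: none; exists G; split=> //; exists p.
have gh : good [set p | exists u, p = (j u, h u)].
  split; last split.
  - by move=> u; exists u.
  - by move=> _ _ [u ->] [u' ->]; exists (u - u'); rewrite !raddfB.
  - move=> y [u [ju ->]]; have -> : u = 0 by apply: jinj; rewrite -ju raddf0.
    by rewrite raddf0.
have gA : good A.
  case: PA => // A0; exfalso; apply: (Amax _ _ (or_intror gh)); rewrite A0.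
  by split=> [p //|/(_ (j 0, h 0))]; apply; exists 0.
have [Ah [AB Af]] := gA.
have Atot v : exists y, A (v, y).
  apply: contrapT => nv; have [e eE] := good_value v gA.
  have A0 : A 0 by rewrite -(subrr (j 0, h 0)); apply: AB.
  (* The extension of [A] by the value [e] at [v]; the choice of [e] makes it single-valued. *)
  pose B := [set p | exists w y n, A (w, y) /\ p = (w + v *~ n, y + e *~ n)].
  apply: (Amax B).
    split=> [[w y] Awy|/(_ (v, e))].
      by exists w, y, 0; rewrite !mulr0z !addr0.
    move=> H; apply: nv; exists e; apply: H; exists 0, 0, 1.
    by rewrite !mulr1z !add0r.
  right; split; last split.
  - by move=> u; exists (j u), (h u), 0; rewrite !mulr0z !addr0.
  - move=> _ _ [w [y [n [Ay ->]]]] [w' [y' [n' [Ay' ->]]]].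
    exists (w - w'), (y - y'), (n - n'); split; first exact: (AB _ _ Ay Ay').
    by rewrite !mulrzBr; apply: (congr2 pair); rewrite /= opprD addrACA.
  - move=> z [w [y [n [Ay [w0 zE]]]]].
    rewrite zE; have -> : e *~ n = - y; last by rewrite subrr.
    apply/esym/eE; have -> : v *~ n = - w.
      by apply/eqP; rewrite -subr_eq0 opprK addrC -w0.
    by have := AB _ _ A0 Ay; rewrite sub0r.
pose h' v := projT1 (cid (Atot v)).
have Ah' v : A (v, h' v) by rewrite /h'; case: cid.
have Auniq v y y' : A (v, y) -> A (v, y') -> y = y'.
  move=> Ay Ay'; have := AB _ _ Ay Ay'; rewrite /= => Ayy.
  by apply/eqP; rewrite -subr_eq0; apply/eqP/Af; rewrite -(subrr v).
have h'B : zmod_morphism h'.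
  by move=> v w; apply: Auniq (Ah' _) (AB _ _ (Ah' v) (Ah' w)).
pose H : {additive V -> D} := HB.pack h' (GRing.isZmodMorphism.Build _ _ _ h'B).
by exists H => u; apply: Auniq (Ah' _) (Ah _).
Qed.

End DivisibleInjective.

(** * Embedding of an abelian group into a divisible one *)

Section DivisibleHull.
Variable M : zmodType.

(* With [M] presented as the quotient of the free abelian group on its elements,
   these are the relations, inside the rational functions on [M]. *)
Definition rel_pred : {pred M -> rat} := fun f => `[< exists s t : seq M,
  \sum_(m <- s) m = \sum_(m <- t) m /\
  forall p, f p = (count_mem p s)%:R - (count_mem p t)%:R >].

Lemma rel_pred_closed : zmod_closed rel_pred.
Proof.
split=> [|f g /asboolP[s [t [st fE]]] /asboolP[s' [t' [st' gE]]]]; apply/asboolP.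
  by exists [::], [::]; split=> // p; rewrite subrr.
exists (s ++ t'), (t ++ s'); split=> [|p]; first by rewrite !big_cat /= st st'.
rewrite -[LHS]/(f p - g p) fE gE !count_cat !natrD !opprD opprK [RHS]addrACA.
by congr (_ + _); rewrite addrC.
Qed.
HB.instance Definition _ := GRing.isZmodClosed.Build (M -> rat) rel_pred rel_pred_closed.

(** A quotient of a rational vector space, hence divisible. *)
Definition hull := Quotient.quot rel_pred.
HB.instance Definition _ := GRing.Zmodule.on hull.
HB.instance Definition _ := EqQuotient.on hull.

Lemma hull_eq (f g : M -> rat) : \pi_hull f = \pi_hull g <-> f - g \in rel_pred.
Proof. by rewrite [_ \in _]Quotient.idealrBE; split=> /eqP. Qed.

Lemma hull_divisible : divisible hull.
Proof.
move=> d x dp; exists (\pi_hull (fun p => (repr x : M -> rat) p / d%:R)).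
rewrite -[RHS]reprK -raddfMn; congr (\pi_hull _); apply/funext => p.
rewrite natmulfctE -[LHS]mulr_natr divfK//.
by rewrite pnatr_eq0 -lt0n.
Qed.

Definition to_hull (m : M) : hull := \pi_hull (fun p => (p == m)%:R).

Lemma to_hull_additive : zmod_morphism to_hull.
Proof.
move=> m m'; rewrite /to_hull -raddfB; apply/hull_eq/asboolP.
exists [:: m - m'; m'], [:: m]; split=> [|p].
  by rewrite !big_cons !big_nil !addr0 subrK.
rewrite /= !addn0 natrD [m == _]eq_sym [m' == _]eq_sym [_ == p]eq_sym.
rewrite -[LHS]/((p == m - m')%:R - ((p == m)%:R - (p == m')%:R)).
by rewrite opprB addrA.
Qed.
HB.instance Definition _ := GRing.isZmodMorphism.Build M hull to_hull to_hull_additive.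

(** If the delta function of [m] is the relation given by [s] and [t], counting shows that [s] is a
    permutation of [m :: t]. As [s] and [t] have equal sums, [m = 0]. *)
Lemma to_hull_inj : injective to_hull.
Proof.
suff ker0 m : to_hull m = 0 -> m = 0.
  by move=> x y /eqP; rewrite -subr_eq0 -raddfB => /eqP/ker0/eqP; rewrite subr_eq0 => /eqP.
have -> : 0 = \pi_hull (0 : M -> rat) by rewrite raddf0.
move=> /hull_eq/asboolP[s [t [st sE]]].
suff : perm_eq s (m :: t).
  move=> sm; have : \sum_(p <- s) p = \sum_(p <- m :: t) p by exact: perm_big.
  by rewrite big_cons st -[LHS]add0r => /addIr.
apply/allP => p _ /=; rewrite -(eqr_nat rat) natrD [m == p]eq_sym -subr_eq -sE.
by rewrite -[X in X == _]/((p == m)%:R - 0) subr0.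
Qed.

End DivisibleHull.

(** * Coinduced modules and embeddings into injectives *)

Section Coinduced.
Variables (R : pzRingType) (D : zmodType).

Definition add_pred : {pred R -> D} := fun f => `[< zmod_morphism f >].
Lemma add_pred_closed : zmod_closed add_pred.
Proof.
split=> [|f g /asboolP fB /asboolP gB]; apply/asboolP => x y.
  by rewrite -[LHS]/(0 : D) -[RHS]/(0 - 0 : D) subrr.
rewrite -[LHS]/(f (x - y) - g (x - y)) fB gB.
by rewrite -[RHS]/((f x - g x) - (f y - g y)) !opprD addrACA.
Qed.
HB.instance Definition _ := GRing.isZmodClosed.Build (R -> D) add_pred add_pred_closed.

Definition coind := {f : R -> D | add_pred f}.
HB.instance Definition _ := SubChoice.on coind.
HB.instance Definition _ := [SubChoice_isSubZmodule of coind by <:].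

Lemma coindB (f : coind) : zmod_morphism (val f).
Proof. exact/asboolP/(valP f). Qed.
Lemma coindD (f : coind) x y : val f (x + y) = val f x + val f y.
Proof.
have f0 : val f 0 = 0 by rewrite -[X in val f X](subrr 0) coindB subrr.
by rewrite -[y in LHS]opprK -[- y in LHS]add0r !coindB f0 sub0r opprK.
Qed.

Lemma coind_scale_subproof (a : R) (f : coind) : add_pred (fun x => val f (x * a)).
Proof. by apply/asboolP => x y; rewrite mulrBl coindB. Qed.
(** Right multiplication in the argument gives a left action. *)
Definition coind_scale (a : R) (f : coind) : coind :=
  exist add_pred _ (coind_scale_subproof a f).

Lemma coind_ext (f g : coind) : (forall x, val f x = val g x) -> f = g.
Proof. by move=> fg; apply/val_inj/funext. Qed.

Lemma coind_scaleA a b f : coind_scale a (coind_scale b f) = coind_scale (a * b) f.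
Proof. by apply: coind_ext => x /=; rewrite mulrA. Qed.
Lemma coind_scale1 : left_id 1 coind_scale.
Proof. by move=> f; apply: coind_ext => x /=; rewrite mulr1. Qed.
Lemma coind_scaleDr : right_distributive coind_scale +%R.
Proof. by move=> a f g; apply: coind_ext. Qed.
Lemma coind_scaleDl f : {morph coind_scale^~ f : a b / a + b}.
Proof. by move=> a b; apply: coind_ext => x /=; rewrite mulrDr coindD. Qed.
HB.instance Definition _ := GRing.Zmodule_isLmodule.Build R coind
  coind_scaleA coind_scale1 coind_scaleDr coind_scaleDl.

(* [coind] is Hom_Z(R, D), and Hom_R(V, Hom_Z(R, D)) = Hom_Z(V, D). *)
Lemma coind_injective : divisible D -> injective_mod coind.
Proof.
move=> divD U V j h jinj.
(* Evaluation at 1 turns [h] into an additive map. An extension [e] of it yields the linear map that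
   sends [v] to the function [e (x *: v)] of [x]. *)
have h1B : zmod_morphism (fun u => val (h u) 1) by move=> u v; rewrite linearB.
pose h1 : {additive U -> D} := HB.pack (fun u => val (h u) 1)
  (GRing.isZmodMorphism.Build _ _ _ h1B).
have [e eE] := divisible_injective h1 divD jinj.
have eP v : add_pred (fun x : R => e (x *: v)).
  by apply/asboolP => x y; rewrite scalerBl raddfB.
pose h' v : coind := exist (fun g => add_pred g) _ (eP v).
have h'lin : linear h'.
  move=> a u v; apply: coind_ext => x /=.
  rewrite -[RHS]/(e ((x * a) *: u) + e (x *: v)).
  by rewrite scalerDr scalerA raddfD.
pose H : {linear V -> coind} := HB.pack h' (GRing.isLinear.Build _ _ _ _ _ h'lin).
exists H => u; apply: coind_ext => x /=.
by rewrite -linearZ eE /h1 /= linearZ /= mul1r.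
Qed.

End Coinduced.

(** The module embeds into the module coinduced from its divisible hull, [m] going to the function
    [x *: m] of [x]; evaluation at 1 shows injectivity. *)
Lemma enough_injectives (R : pzRingType) (M : lmodType R) :
  exists (E : lmodType R) (f : {linear M -> E}), injective_mod E /\ injective f.
Proof.
have aP (m : M) : add_pred (fun x : R => to_hull (x *: m)).
  by apply/asboolP => x y; rewrite scalerBl raddfB.
pose f m : coind R (hull M) := exist (fun g => add_pred g) _ (aP m).
have flin : linear f.
  move=> a u v; apply: coind_ext => x /=.
  rewrite -[RHS]/(to_hull ((x * a) *: u) + to_hull (x *: v)).
  by rewrite scalerDr scalerA raddfD.
pose F : {linear M -> coind R (hull M)} :=
  HB.pack f (GRing.isLinear.Build _ _ _ _ _ flin).
exists (coind R (hull M)), F; split; first exact/coind_injective/hull_divisible.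
move=> u v /(congr1 (fun g : coind R (hull M) => val g 1)) /=.
by rewrite !scale1r => /to_hull_inj.
Qed.

(** * J-completions *)

Section Cosyzygy.
Variables (R : pzRingType) (N : lmodType R).

Definition inj_hull : lmodType R := projT1 (cid (enough_injectives N)).
Definition inj_emb : {linear N -> inj_hull} :=
  projT1 (cid (projT2 (cid (enough_injectives N)))).

Lemma inj_hullP : injective_mod inj_hull /\ injective inj_emb.
Proof. exact: projT2 (cid (projT2 (cid (enough_injectives N)))). Qed.

Lemma cosyz_exact : exact_pair inj_emb (to_coker inj_emb : {linear _ -> cokernel _}).
Proof. by move=> x; apply: to_coker_eq0. Qed.
Lemma cosyz_surj : onto (to_coker inj_emb : {linear _ -> cokernel _}).
Proof. exact: to_coker_surj. Qed.

Definition cosyz : ses R := Ses (proj2 inj_hullP) cosyz_exact cosyz_surj.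

(** Injectivity of the hull extends [f] to the middle terms, and the quotients inherit a map.
    Although chosen without functoriality, cosyzygies thus behave well enough for naturality
    arguments. *)
Lemma cosyz_map (s : ses R) (f : {linear ses_l s -> N}) :
  exists h : ses_map s cosyz, smap_l h = f.
Proof.
have [injE _] := inj_hullP.
have [m mE] := injE _ _ (ses_f s) (inj_emb \o f) (@ses_inj _ s).
have [|b u v u' v'|v|r rE] := @linear_of_rel R (ses_r s) (cokernel inj_emb)
  (fun w c => exists y, ses_g s y = w /\ to_coker inj_emb (m y) = c).
- by move=> w; have [y yw] := ses_surj w; exists (to_coker inj_emb (m y)), y.
- by move=> [y [<- <-]] [y' [<- <-]]; exists (b *: y + y'); rewrite !linearP.
- move=> [y [/ses_exact[x <-] <-]]; rewrite mE.
  by apply/to_coker_eq0; exists (f x).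
unshelve eexists (@SesMap _ s cosyz f m r _ _) => //.
by move=> y; apply/rE; exists y.
Qed.

End Cosyzygy.

Section NaturalRelation.
Variables (k : comPzRingType) (R : algebra k) (F G : mod_functor R).

(** Allows a transformation to be given by its graph, for instance as a composite with the inverse
    of a bijection. *)
Lemma nat_trans_of_rel (L : forall N, F N -> G N -> Prop) :
  (forall N u, exists v, L N u v) ->
  (forall N a u v u' v', L N u v -> L N u' v' -> L N (a *: u + u') (a *: v + v')) ->
  (forall N v, L N 0 v -> v = 0) ->
  (forall (M N : lmodType R) (f : {linear M -> N}) u v, L M u v -> L N (fmap F f u) (fmap G f v)) ->
  exists eta : nat_trans F G, forall N u v, L N u v <-> eta N u = v.
Proof.
move=> Ltot Llin L0 Lnat.
have ex N := linear_of_rel (Ltot N) (Llin N) (L0 N).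
pose eta N := projT1 (cid (ex N)).
have etaP N u v : L N u v <-> eta N u = v by rewrite /eta; case: cid.
unshelve eexists (@NatTrans _ _ F G eta _) => //.
by move=> M N f u; apply/etaP/Lnat/etaP.
Qed.

End NaturalRelation.

(** * J-families that agree with a given family in high degrees *)

Section Completion.
Variables (k : comPzRingType) (R : algebra k).

Section ConnBijective.
Variables (U : functor_family R) (JU : J_family U).
Variables (s : ses R) (injs : injective_mod (ses_m s)) (i : int).

(** In the long exact sequence [conn] stands between values at the injective middle term, which are
    0. This gives injectivity here and surjectivity in [conn_surj]. *)
Lemma conn_inj : injective (conn U s i).
Proof.
suff ker0 x : conn U s i x = 0 -> x = 0.
  move=> x y xy; apply/eqP; rewrite -subr_eq0; apply/eqP/ker0.
  by rewrite linearB /= xy subrr.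
have [JE /(_ s injs i)[_ ex _]] := JU.
by move=> /ex[y <-]; rewrite (JE _ injs _ y) linear0.
Qed.

Lemma conn_surj : onto (conn U s i).
Proof.
by have [JE /(_ s injs i)[_ _ ex]] := JU; move=> y; apply/ex; apply: JE.
Qed.
End ConnBijective.

Variables (T C : functor_family R) (tau : family_map C T) (n : int).
Hypothesis JC : J_family C.
Hypothesis tauB : forall i : int, n <= i -> forall N, bijective (tau i N).

Let tau_inj (i : int) (N : lmodType R) : n <= i -> injective (tau i N).
Proof. by move=> /tauB/(_ N)/bij_inj. Qed.

Section Lift.
Variables (U : functor_family R) (ups : family_map U T).
Hypothesis JU : J_family U.

Let injc (N : lmodType R) : injective_mod (ses_m (cosyz N)). Proof. by case: (inj_hullP N). Qed.

(** One pass of the descending construction. In degrees [>= n] the value is forced by [tau]; below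
    [n] it is taken from [sigma] one degree up, through the connecting maps of the cosyzygy
    sequence, which are bijective for [U]. As [sigma] is arbitrary, passes can be iterated. *)
Lemma lift_step (sigma : forall i, nat_trans (U i) (C i)) i :
  exists sigma' : nat_trans (U i) (C i),
    (n <= i -> forall N x, tau i N (sigma' N x) = ups i N x) /\
    (i < n -> forall N u, sigma' N (conn U (cosyz N) i u) =
                          conn C (cosyz N) i (sigma (i + 1) _ u)).
Proof.
have [ni|ni] := leP n i.
  have [|N a u v u' v' uv uv'|N v|M N f u v uv|s sE] :=
    @nat_trans_of_rel _ _ (U i) (C i) (fun N u c => tau i N c = ups i N u).
  - by move=> N u; have [g _ gK] := tauB ni N; exists (g (ups i N u)).
  - by rewrite !linearP uv uv'.
  - by rewrite linear0 => v0; apply: (tau_inj ni); rewrite linear0.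
  - by rewrite !ntrans_nat uv.
  by exists s; split=> // _ N x; apply/sE.
pose L N u c := exists u', conn U (cosyz N) i u' = u /\
   conn C (cosyz N) i (sigma (i + 1) _ u') = c.
have [|N a u v u' v'|N v|M N f u v|s sE] := @nat_trans_of_rel _ _ (U i) (C i) L.
- move=> N u; have [u' <-] := conn_surj JU (@injc N) u.
  by exists (conn C (cosyz N) i (sigma (i + 1) _ u')), u'.
- move=> [w [<- <-]] [w' [<- <-]]; exists (a *: w + w').
  by rewrite !linearP.
- move=> [u [u0 <-]]; have -> : u = 0.
    by apply: (conn_inj JU (@injc N)); rewrite u0 linear0.
  by rewrite !linear0.
(* Naturality: [f] extends to a map of cosyzygy sequences, with which the connecting maps of both
   families commute. *)
- move=> [w [<- <-]]; have [h hE] := @cosyz_map _ _ (cosyz M) f.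
  exists (fmap (U (i + 1)) (smap_r h) w).
  by rewrite -hE !(conn_nat h) ntrans_nat.
exists s; split=> // _ N u; apply/sE; by exists u.
Qed.

Definition lift_next sigma i : nat_trans (U i) (C i) :=
  projT1 (cid (lift_step sigma i)).

Lemma lift_nextP sigma i :
    (n <= i -> forall N x, tau i N (lift_next sigma i N x) = ups i N x) /\
    (i < n -> forall N u, lift_next sigma i N (conn U (cosyz N) i u) =
                          conn C (cosyz N) i (sigma (i + 1) _ u)).
Proof. exact: projT2 (cid (lift_step sigma i)). Qed.

(** Starting value of the iteration; the first pass overwrites it in degrees [>= n]. *)
Lemma zero_nat (F G : mod_functor R) : nat_trans F G.
Proof.
by exists (fun N => \0 : {linear F N -> G N}) => M N f x /=; rewrite linear0.
Defined.

(* Correct in degrees [>= n - m]. *)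
Definition lift_iter m : forall i, nat_trans (U i) (C i) :=
  iter m.+1 lift_next (fun i => zero_nat (U i) (C i)).

(** From [n] upwards both sides agree because [tau] is injective; each lower degree reduces to the
    one above it at the cost of one pass. *)
Lemma lift_iter_stable m (i : int) N x :
  n - m%:Z <= i -> lift_iter m.+1 i N x = lift_iter m i N x.
Proof.
elim: m i N x => [|m IH] i N x mi.
  have ni : n <= i by lia.
  by apply: (tau_inj ni); rewrite !(proj1 (lift_nextP _ _) ni).
have [ni|ni] := leP n i.
  by apply: (tau_inj ni); rewrite !(proj1 (lift_nextP _ _) ni).
have [u <-] := conn_surj JU (@injc N) x.
rewrite !(proj2 (lift_nextP _ _) ni) -/(lift_iter m.+1) -/(lift_iter m).
by apply: (congr1 (conn C (cosyz N) i)); apply: IH; lia.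
Qed.

Lemma lift_iter_le m m' (i : int) N x :
  (m <= m')%N -> n - m%:Z <= i -> lift_iter m' i N x = lift_iter m i N x.
Proof.
move=> /subnK <- mi; elim: (m' - m)%N => [|d IH]; first by rewrite add0n.
by rewrite addSn lift_iter_stable ?IH//; lia.
Qed.

(** The index [|n - i|] suffices, since [n - |n - i| <= i]. *)
Definition lift i : nat_trans (U i) (C i) := lift_iter `|n - i| i.

Lemma lift_iterE m (i : int) N x : n - m%:Z <= i -> lift_iter m i N x = lift i N x.
Proof.
move=> mi; have h : n - `|n - i|%N%:Z <= i by lia.
have [le|le] := leqP m `|n - i|; first by rewrite /lift (lift_iter_le _ le).
by rewrite (lift_iter_le _ (ltnW le)).
Qed.

Lemma lift_conn_cosyz (i : int) N u : i < n ->
  lift i N (conn U (cosyz N) i u) = conn C (cosyz N) i (lift (i + 1) _ u).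
Proof.
(* As [i < n], the index is a successor: the outer pass computes degree [i], and the iterate with
   one pass fewer is still correct in degree [i + 1]. *)
move=> ni; rewrite -(@lift_iterE `|n - i|%N.-1.+1); last by lia.
rewrite (proj2 (lift_nextP _ _) ni) -/(lift_iter `|n - i|%N.-1).
by rewrite lift_iterE//; lia.
Qed.

Lemma down_ind (P : int -> Prop) : (forall i, n <= i -> P i) ->
  (forall i, i < n -> P (i + 1) -> P i) -> forall i, P i.
Proof.
move=> P0 PS i; have [m] : exists m : nat, n - m%:Z <= i.
  by exists `|n - i|%N; lia.
elim: m i => [|m IH] i mi; first by apply: P0; lia.
have [ni|ni] := leP n i; first exact: P0.
by apply: PS => //; apply: IH; lia.
Qed.

(** Below [n] every element is a connecting image, and [lift], [tau] and [ups] commute with [conn]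
    there, so the identity descends from degree [i + 1]. *)
Lemma lift_tau i N x : tau i N (lift i N x) = ups i N x.
Proof.
elim/down_ind: i N x => i ni; last move=> IH.
  move=> N x; rewrite -(@lift_iterE 0%N); last by lia.
  exact: (proj1 (lift_nextP _ _) ni).
move=> N x; have [u <-] := conn_surj JU (@injc N) x.
by rewrite lift_conn_cosyz// (@fam_conn _ _ _ _ tau (cosyz N)) (@fam_conn _ _ _ _ ups (cosyz N)) IH.
Qed.

(* Every short exact sequence maps to an injective cosyzygy sequence of its left
   term, identically on that term. *)
Lemma lift_conn (s : ses R) i x :
  lift i (ses_l s) (conn U s i x) = conn C s i (lift (i + 1) (ses_r s) x).
Proof.
have [ni|ni] := leP n i.
  by apply: (tau_inj ni); rewrite lift_tau !fam_conn lift_tau.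
have [h hE] := cosyz_map (idfun : {linear ses_l s -> ses_l s}).
have connE (F : functor_family R) y :
    conn F s i y = conn F (cosyz (ses_l s)) i (fmap (F (i + 1)) (smap_r h) y).
  by rewrite -(conn_nat h) hE fmap_id.
by rewrite !connE lift_conn_cosyz// ntrans_nat.
Qed.

(** The same descent, started by the injectivity of [tau] in high degrees. *)
Lemma lift_unique (sigma : family_map U C) :
  (forall i N x, tau i N (sigma i N x) = ups i N x) ->
  forall i N x, sigma i N x = lift i N x.
Proof.
move=> sE i; elim/down_ind: i => i ni; last move=> IH.
  by move=> N x; apply: (tau_inj ni); rewrite sE lift_tau.
move=> N x; have [u <-] := conn_surj JU (@injc N) x.
by rewrite lift_conn_cosyz// (@fam_conn _ _ _ _ sigma (cosyz N)) IH.
Qed.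

End Lift.

Lemma J_completion_of_stable : J_completion tau.
Proof.
split=> // U ups JU; exists (FamilyMap (lift_conn ups JU)); split.
  exact: lift_tau.
exact: lift_unique.
Qed.

End Completion.

(** * Homology of flat complexes *)

Section LongExact.
Variables (A : pzRingType) (X Y Z : complex A).
Variables (f : chain_map X Y) (g : chain_map Y Z).
Hypothesis finj : forall i, injective (f i).
Hypothesis fg : forall i y, g i y = 0 <-> exists x, f i x = y.
Hypothesis gsurj : forall i z, exists y, g i y = z.
Variable i : int.

Lemma homology_exact_mid : exact_pair (@homology_map _ _ _ f i) (@homology_map _ _ _ g i).
Proof.
move=> c; split=> [|[a <-]]; last first.
  have [x <-] := hclass_surj a; rewrite /= homology_mapE /cycle_map homology_mapE.
  apply/hclass_eq0; exists 0; rewrite linear0 /=.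
  by apply/esym/fg; exists (val x).
have [y <-] := hclass_surj c; rewrite /= homology_mapE => /hclass_eq0[z zE].
have [y' y'z] := gsurj z.
have /fg[x xE] : g i (val y - diff Y (i + 1) i y') = 0.
  by rewrite linearB /= chain_diff y'z zE subrr.
have dx : diff X i (i - 1) x = 0.
  apply: (@finj (i - 1)).
  by rewrite chain_diff xE linearB /= cycle_diff diff_diff subrr linear0.
exists (hclass (mk_cycle dx)); rewrite /= homology_mapE /cycle_map.
apply/eqP; rewrite -subr_eq0 -linearB; apply/eqP/hclass_eq0.
by exists (- y'); rewrite linearN /= xE addrAC subrr add0r.
Qed.

Lemma homology_exact_right : exact_pair (@homology_map _ _ _ g (i + 1))
  (connecting finj fg gsurj i).
Proof.
move=> c; split=> [/connectingP[z [y [x [-> /esym/hclass_eq0[x' x'x] yz xy]]]]|[b <-]].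
  (* Since [x'] bounds the connecting image, [y - f x'] is a cycle, and it still lifts [z]. *)
  have dy : diff Y (i + 1) (i + 1 - 1) (y - f (i + 1) x') = 0.
    apply: (@diff_eqj _ _ _ i); first by rewrite addrK.
    by rewrite linearB /= -chain_diff x'x -xy subrr.
  exists (hclass (mk_cycle dy)); rewrite /= homology_mapE; congr hclass; apply: val_inj.
  rewrite /= linearB /= yz; have -> : g (i + 1) (f (i + 1) x') = 0.
    by apply/fg; exists x'.
  by rewrite subr0.
have [y <-] := hclass_surj b; apply/connectingP.
exists (mk_cycle (cycle_map_subproof g y)), (val y), 0; split=> //.
- exact: homology_mapE.
- by rewrite linear0.
- by rewrite !linear0 cycle_diff.
Qed.

Lemma homology_exact_left : exact_pair (connecting finj fg gsurj i) (@homology_map _ _ _ f i).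
Proof.
move=> a; split=> [|[c /connectingP[z [y [x [_ -> yz xy]]]]]]; last first.
  by rewrite /= homology_mapE; apply/hclass_eq0; exists y; rewrite /= xy.
have [x <-] := hclass_surj a; rewrite /= homology_mapE => /hclass_eq0[y yE].
have dz : diff Z (i + 1) (i + 1 - 1) (g (i + 1) y) = 0.
  apply: (@diff_eqj _ _ _ i); first by rewrite addrK.
  by rewrite -chain_diff yE; apply/fg; exists (val x).
exists (hclass (mk_cycle dz)); apply/connectingP.
by exists (mk_cycle dz), y, x; split; rewrite //= yE.
Qed.

End LongExact.

Section FlatHomology.
Variables (k : comPzRingType) (R : algebra k).

Section Family.
Variables (X : complex R^c) (flatX : forall i, flat_mod (X i)).

Section Connecting.
Variable s : ses R.
Let f := tens_cpx_map X (ses_f s).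
Let g := tens_cpx_map X (ses_g s).

Lemma flat_cpx_inj j : injective (f j).
Proof. exact: flatX (@ses_inj _ s). Qed.
Lemma flat_cpx_exact j y : g j y = 0 <-> exists x, f j x = y.
Proof. exact: (@tmap_exact _ _ (X j) _ _ _ _ _ (@ses_exact _ s) (@ses_surj _ s) y). Qed.
Lemma flat_cpx_surj j z : exists y, g j y = z.
Proof. exact: (@tmap_surj _ _ (X j) _ _ _ (@ses_surj _ s) z). Qed.

Definition flat_conn i :
    {linear homology_functor X (i + 1) (ses_r s) -> homology_functor X i (ses_l s)} :=
  connecting flat_cpx_inj flat_cpx_exact flat_cpx_surj i.
End Connecting.

(** The connecting map is determined by its graph [snake], and the three components of [h] carry a
    snake for [s] to a snake for [t]. *)
Lemma flat_conn_nat (s t : ses R) (h : ses_map s t) i x :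
  fmap (homology_functor X i) (smap_l h) (flat_conn s i x) =
  flat_conn t i (fmap (homology_functor X (i + 1)) (smap_r h) x).
Proof.
apply/esym/connectingP.
have /connectingP[z [y [w [-> -> yz wy]]]] := erefl (flat_conn s i x).
have Ez := cycle_map_subproof (tens_cpx_map X (smap_r h)) z.
have Ew := cycle_map_subproof (tens_cpx_map X (smap_l h)) w.
exists (mk_cycle Ez), (tens_cpx_map X (smap_m h) (i + 1) y), (mk_cycle Ew); split.
- exact: homology_mapP.
- exact: homology_mapP.
- rewrite /= -yz /= !(tmap_comp (f'' := idfun) (g'' := smap_r h \o ses_g s))//.
  by move=> u /=; rewrite smap_g.
- rewrite -[RHS]chain_diff -wy /=.
  rewrite !(tmap_comp (f'' := idfun) (g'' := smap_m h \o ses_f s))//.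
  by move=> u /=; rewrite smap_f.
Qed.

Definition flat_homology : functor_family R := Family flat_conn_nat.

Lemma flat_homology_long_exact s : long_exact flat_homology s.
Proof.
move=> i; split.
- exact: homology_exact_mid (@flat_cpx_inj s) (@flat_cpx_exact s) (@flat_cpx_surj s) i.
- exact: homology_exact_right (@flat_cpx_inj s) (@flat_cpx_exact s) (@flat_cpx_surj s) i.
- exact: homology_exact_left (@flat_cpx_inj s) (@flat_cpx_exact s) (@flat_cpx_surj s) i.
Qed.

End Family.

Section Induced.
Variables (X Y : complex R^c) (phi : chain_map X Y).

Definition tens_map_fun (N : lmodType R) i : {linear tens_cpx X N i -> tens_cpx Y N i} :=
  tmap (phi i) (idfun : {linear N -> N}).

Lemma tens_map_diff N i j x : tens_map_fun N j (diff (tens_cpx X N) i j x) =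
  diff (tens_cpx Y N) i j (tens_map_fun N i x).
Proof.
rewrite /tens_map_fun /= (tmap_comp (f'' := diff Y i j \o phi i) (g'' := idfun))//.
  by rewrite (tmap_comp (f'' := diff Y i j \o phi i) (g'' := idfun)).
by move=> u /=; rewrite chain_diff.
Qed.

Definition tens_map N : chain_map (tens_cpx X N) (tens_cpx Y N) :=
  ChainMap (tens_map_diff (N := N)).

Definition hom_trans_fun i (N : lmodType R) :
    {linear homology_functor X i N -> homology_functor Y i N} :=
  @homology_map _ _ _ (tens_map N) i.

Lemma hom_trans_nat i (M N : lmodType R) (f : {linear M -> N}) x :
  hom_trans_fun i N (fmap (homology_functor X i) f x) =
  fmap (homology_functor Y i) f (hom_trans_fun i M x).
Proof.
have [z <-] := hclass_surj x.
have Ez := cycle_map_subproof (tens_cpx_map X f) z.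
have Ew := cycle_map_subproof (tens_map N) (mk_cycle Ez).
have Fz := cycle_map_subproof (tens_map M) z.
have Fw := cycle_map_subproof (tens_cpx_map Y f) (mk_cycle Fz).
have -> : fmap (homology_functor X i) f (hclass z) = hclass (mk_cycle Ez).
  exact: homology_mapP.
have -> : hom_trans_fun i M (hclass z) = hclass (mk_cycle Fz) by exact: homology_mapP.
have -> : hom_trans_fun i N (hclass (mk_cycle Ez)) = hclass (mk_cycle Ew).
  exact: homology_mapP.
have -> : fmap (homology_functor Y i) f (hclass (mk_cycle Fz)) = hclass (mk_cycle Fw).
  exact: homology_mapP.
congr hclass; apply: val_inj => /=.
rewrite /tens_map_fun /tens_cpx_fun (tmap_comp (f'' := phi i) (g'' := f))//.
by rewrite (tmap_comp (f'' := phi i) (g'' := f)).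
Qed.

Definition hom_trans i : nat_trans (homology_functor X i) (homology_functor Y i) :=
  NatTrans (hom_trans_nat (i := i)).

End Induced.

(** Here [s] is fixed, and the chain map [phi] carries snakes to snakes. *)
Lemma hom_trans_conn (M : lmodType R^c) (P : proj_resolution M) (X : complex R^c)
    (flatX : forall i, flat_mod (X i)) (phi : chain_map X P) (s : ses R) i x :
  hom_trans phi i (ses_l s) (conn (flat_homology flatX) s i x) =
  conn (tor P) s i (hom_trans phi (i + 1) (ses_r s) x).
Proof.
apply/esym/connectingP.
have /connectingP[z [y [w [-> -> yz wy]]]] := erefl (flat_conn flatX s i x).
have Ez := cycle_map_subproof (tens_map phi (ses_r s)) z.
have Ew := cycle_map_subproof (tens_map phi (ses_l s)) w.
exists (mk_cycle Ez), (tens_map phi (ses_m s) (i + 1) y), (mk_cycle Ew); split.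
- exact: homology_mapP.
- exact: homology_mapP.
- rewrite /= -yz /= /tens_map_fun /tens_cpx_fun.
  by rewrite !(tmap_comp (f'' := phi (i + 1)) (g'' := ses_g s)).
- rewrite -[RHS]chain_diff -wy /= /tens_map_fun /tens_cpx_fun.
  by rewrite !(tmap_comp (f'' := phi i) (g'' := ses_f s)).
Qed.

Definition hom_family_map (M : lmodType R^c) (P : proj_resolution M) (X : complex R^c)
    (flatX : forall i, flat_mod (X i)) (phi : chain_map X P) :
    family_map (flat_homology flatX) (tor P) :=
  FamilyMap (U := flat_homology flatX) (T := tor P) (@hom_trans_conn M P X flatX phi).

End FlatHomology.

(** * Comparison of projective resolutions *)

Lemma inj_onto_bij (A : pzRingType) (V W : lmodType A) (f : {linear V -> W}) :
  injective f -> onto f -> bijective f.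
Proof.
move=> finj fs; exists (fun w => projT1 (cid (fs w))) => [v|w].
  by apply: finj; case: cid.
by case: cid.
Qed.

(** Only linear maps can be tensored, so the inverse provided by [bijective] has to be made
    linear. *)
Lemma linear_inverse (A : pzRingType) (V W : lmodType A) (f : {linear V -> W}) :
  bijective f -> exists g : {linear W -> V}, cancel f g /\ cancel g f.
Proof.
move=> [g fK gK].
have [|a u v u' v' <- <-|v v0|h hE] := @linear_of_rel A W V (fun w v => f v = w).
- by move=> w; exists (g w).
- by rewrite linearP.
- by rewrite -(fK v) v0 -(linear0 f) fK.
by exists h; split=> x; [apply/hE|apply/hE].
Qed.

(** By exactness [a] maps onto [kernel b], where [h] takes its values. *)
Lemma projective_lift (A : pzRingType) (P U V W : lmodType A)
    (a : {linear U -> V}) (b : {linear V -> W}) (h : {linear P -> V}) :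
  projective_mod P -> exact_pair a b -> (forall x, b (h x) = 0) ->
  exists h' : {linear P -> U}, forall x, a (h' x) = h x.
Proof.
move=> projP ab bh.
have a0 u : b (a u) = 0 by apply/ab; exists u.
pose a' u : kernel b := to_kernel (a0 u).
have a'lin : linear a' by move=> c u v; apply: val_inj; rewrite /= linearP.
pose h1 x : kernel b := to_kernel (bh x).
have h1lin : linear h1 by move=> c u v; apply: val_inj; rewrite /= linearP.
pose aL : {linear U -> kernel b} := HB.pack a' (GRing.isLinear.Build _ _ _ _ _ a'lin).
pose hL : {linear P -> kernel b} := HB.pack h1 (GRing.isLinear.Build _ _ _ _ _ h1lin).
have [v|h' h'E] := projP _ _ aL hL.
  have /ab[u uv] := kernelP v; exists u; exact: val_inj.
by exists h' => x; have /(congr1 val) := h'E x.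
Qed.

Section ChainMaps.
Variable A : pzRingType.
Implicit Types X Y Z : complex A.

Lemma comp_chain_diff X Y Z (f : chain_map X Y) (g : chain_map Y Z) i j x :
  (g j \o f j) (diff X i j x) = diff Z i j ((g i \o f i) x).
Proof. by rewrite /= !chain_diff. Qed.
Definition comp_chain X Y Z (f : chain_map X Y) (g : chain_map Y Z) : chain_map X Z :=
  ChainMap (comp_chain_diff f g).

Lemma id_chain_diff X i j x :
  (idfun : {linear X j -> X j}) (diff X i j x) = diff X i j ((idfun : {linear X i -> X i}) x).
Proof. by []. Qed.
Definition id_chain X : chain_map X X := ChainMap (@id_chain_diff X).

(** Homology in degree [i] involves only the degrees [i - 1], [i] and [i + 1]. *)
Lemma homology_map_bij X Y (f : chain_map X Y) (i : int) :
  (forall j : int, i - 1 <= j -> bijective (f j)) -> bijective (@homology_map _ _ _ f i).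
Proof.
move=> fB.
apply: (@inj_onto_bij _ _ _ (@homology_map _ _ _ f i : {linear _ -> _})).
- suff ker0 (c : homology X i) : homology_map f c = 0 -> c = 0.
    move=> x y xy; apply/eqP; rewrite -subr_eq0; apply/eqP/ker0.
    by rewrite linearB /= xy subrr.
  have [z <-] := hclass_surj c; rewrite homology_mapE => /hclass_eq0[y yz].
  have [|g fK gK] := fB (i + 1); first by lia.
  apply/hclass_eq0; exists (g y); have [|h hK _] := fB i; first by lia.
  by apply: (can_inj hK); rewrite chain_diff gK yz.
- move=> c; have [z <-] := hclass_surj c.
  have [|g fK gK] := fB i; first by lia.
  have dg : diff X i (i - 1) (g (val z)) = 0.
    have [|h hK _] := fB (i - 1); first by lia.
    by apply: (can_inj hK); rewrite chain_diff gK cycle_diff linear0.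
  exists (hclass (mk_cycle dg)); rewrite /= homology_mapE /cycle_map.
  by congr hclass; apply: val_inj; rewrite /= gK.
Qed.

End ChainMaps.

Section Comparison.
Variables (A : pzRingType) (M : lmodType A).
Implicit Types P Q : proj_resolution M.

Lemma pres_exact_at Q (l i j : int) : l = i + 1 -> i = j + 1 -> 0 < i ->
  exact_pair (diff Q l i) (diff Q i j).
Proof.
move=> -> ij i0; have -> : j = i - 1 by lia.
exact: pres_exact.
Qed.

Section Lift.
Variables P Q : proj_resolution M.

Lemma lift_start : exists p : {linear P 0 -> Q 0} * {linear P 1 -> Q 1},
  (forall x, diff Q 1 0 (p.2 x) = p.1 (diff P 1 0 x)) /\
  (forall x, pres_aug Q (p.1 x) = pres_aug P x).
Proof.
have [f0 f0E] := @pres_proj _ _ P 0 _ _ (pres_aug Q) (pres_aug P) (@pres_surj _ _ Q).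
have [x|f1 f1E] := projective_lift (h := f0 \o diff P 1 0)
  (@pres_proj _ _ P 1) (@pres_exact0 _ _ Q).
  by rewrite /= f0E; apply/pres_exact0; exists x.
by exists (f0, f1).
Qed.

(** A stage holds two consecutive components, because constructing the next one requires the
    commutation of the square between them. *)
Definition lift_stage (n : nat) :=
  {p : {linear P n -> Q n} * {linear P n.+1 -> Q n.+1} |
    forall x, diff Q n.+1 n (p.2 x) = p.1 (diff P n.+1 n x)}.

Lemma lift_succ_ex n (s : lift_stage n) : exists h : {linear P n.+2 -> Q n.+2},
  forall x, diff Q n.+2 n.+1 (h x) = (sval s).2 (diff P n.+2 n.+1 x).
Proof.
apply: (projective_lift (h := (sval s).2 \o diff P n.+2 n.+1) (@pres_proj _ _ P n.+2)
  (@pres_exact_at Q n.+2 n.+1 n _ _ _)); try lia.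
by move=> x; rewrite /= (svalP s) diff_diff linear0.
Qed.

Definition lift_succ n (s : lift_stage n) : lift_stage n.+1 :=
  exist _ ((sval s).2, projT1 (cid (lift_succ_ex s))) (projT2 (cid (lift_succ_ex s))).

Fixpoint lift_stages n : lift_stage n :=
  if n is n'.+1 then lift_succ (lift_stages n') else
  exist _ (projT1 (cid lift_start)) (proj1 (projT2 (cid lift_start))).

Definition lift_fun (i : int) : {linear P i -> Q i} :=
  match i with Posz n => (sval (lift_stages n)).1 | Negz n => \0 end.

Lemma lift_fun_diff i j x : lift_fun j (diff P i j x) = diff Q i j (lift_fun i x).
Proof.
have [ij|ij] := pselect (i = j + 1); last by rewrite !diff_shape// linear0.
case: j ij x => [n|n] ij.
  have -> : i = n.+1 by lia.
  by move=> x; exact: esym (svalP (lift_stages n) x).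
by move=> x; rewrite [RHS](@pres_neg _ _ Q) //= .
Qed.

Lemma comparison : exists f : chain_map P Q, forall x, pres_aug Q (f 0 x) = pres_aug P x.
Proof.
exists (ChainMap lift_fun_diff) => x.
exact: (proj2 (projT2 (cid lift_start))).
Qed.

End Lift.

(* The free indices [l] and [j] stand for [i + 1] and [i - 1]: the induction step
   turns the component out of degree [i] into the one out of degree [(i + 1) - 1]. *)
Lemma comparison_homotopy P Q (f g : chain_map P Q) :
  (forall x, pres_aug Q (f 0 x) = pres_aug Q (g 0 x)) ->
  forall l i j : int, l = i + 1 -> i = j + 1 ->
  exists (s : {linear P i -> Q l}) (r : {linear P j -> Q i}),
    forall x, f i x - g i x = diff Q l i (s x) + r (diff P i j x).
Proof.
move=> fg l i j li ij; have [i0|i0] := ltP i 0.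
  exists \0, \0 => x; by rewrite (@pres_neg _ _ P _ x i0) !linear0.
case: i i0 l j li ij => // n _; elim: n => [|n IH] l j li ij.
  have el : l = 1 by lia.
  subst l; pose h : {linear P 0 -> Q 0} := f 0 \- g 0.
  have [x|s sE] := projective_lift (h := h) (@pres_proj _ _ P 0) (@pres_exact0 _ _ Q).
    by rewrite /= linearB /= fg subrr.
  exists s, \0 => x; by rewrite sE /= addr0.
have ej : j = n by lia.
subst j; have [||s [r srE]] := IH n.+1 (n%:Z - 1); try lia.
(* After subtraction of the previous homotopy term the difference takes values in cycles, so it
   lifts through the differential. *)
pose h : {linear P n.+1 -> Q n.+1} := (f n.+1 \- g n.+1) \- (s \o diff P n.+1 n).
have [x|t tE] := projective_lift (h := h) (@pres_proj _ _ P n.+1)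
  (@pres_exact_at Q l n.+1 n li ij isT).
  rewrite /= 2!linearB /= -!chain_diff srE diff_diff linear0 addr0.
  exact: subrr.
by exists t, s => x; rewrite tE /= subrK.
Qed.

End Comparison.

(** * Independence of Tor from the resolution *)

Section ComparisonHomology.
Variables (k : comPzRingType) (R : algebra k).

Lemma tmapDl (M M' : lmodType R^c) (N : lmodType R) (f g h : {linear M -> M'}) :
  (forall x, h x = f x + g x) -> forall x,
  tmap h (idfun : {linear N -> N}) x =
  tmap f (idfun : {linear N -> N}) x + tmap g (idfun : {linear N -> N}) x.
Proof.
move=> hE; elim/tens_ind => [|m n|x IH|x y IHx IHy].
- by rewrite !raddf0 addr0.
- by rewrite !tmap_pure hE pureDl.
- by rewrite !raddfN /= IH opprD.
- by rewrite !raddfD /= IHx IHy addrACA.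
Qed.

(** On a cycle the homotopy term through the differential of [P] vanishes, and the other term is a
    boundary. *)
Lemma hom_trans_homotopy (M : lmodType R^c) (P Q : proj_resolution M) (f g : chain_map P Q) :
  (forall x, pres_aug Q (f 0 x) = pres_aug Q (g 0 x)) ->
  forall i (N : lmodType R) x, hom_trans f i N x = hom_trans g i N x.
Proof.
move=> fg i N x; have [z <-] := hclass_surj x.
have Fz := cycle_map_subproof (tens_map f N) z.
have Gz := cycle_map_subproof (tens_map g N) z.
have -> : hom_trans f i N (hclass z) = hclass (mk_cycle Fz) by exact: homology_mapP.
have -> : hom_trans g i N (hclass z) = hclass (mk_cycle Gz) by exact: homology_mapP.
apply/eqP; rewrite -subr_eq0 -linearB; apply/eqP/hclass_eq0.
have [s [r srE]] := comparison_homotopy fg (erefl (i + 1)) (esym (subrK 1 i)).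
exists (tmap s (idfun : {linear N -> N}) (val z)); rewrite linearB /=.
rewrite /tens_map_fun; apply/eqP; rewrite eq_sym subr_eq; apply/eqP.
pose ds : {linear P i -> Q i} := diff Q (i + 1) i \o s.
pose rd : {linear P i -> Q i} := r \o diff P i (i - 1).
pose dsrd : {linear P i -> Q i} := ds \+ rd.
rewrite (@tmapDl _ _ _ dsrd (g i)) => [|x']; last by rewrite /= -srE subrK.
congr (_ + _); rewrite (@tmapDl _ _ _ ds rd)//.
rewrite -(tmap_comp (f := s) (f' := diff Q (i + 1) i) (g := idfun) (g' := idfun))//.
rewrite -[X in _ + X](tmap_comp (f := diff P i (i - 1)) (f' := r) (g := idfun) (g' := idfun))//.
by have := kernelP z; rewrite /= /tens_diff => ->; rewrite linear0 addr0.
Qed.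

Lemma hom_trans_comp (X Y Z : complex R^c) (f : chain_map X Y) (g : chain_map Y Z) i
    (N : lmodType R) x :
  hom_trans (comp_chain f g) i N x = hom_trans g i N (hom_trans f i N x).
Proof.
have [z <-] := hclass_surj x.
have Fz := cycle_map_subproof (tens_map f N) z.
have Gz := cycle_map_subproof (tens_map g N) (mk_cycle Fz).
have -> : hom_trans f i N (hclass z) = hclass (mk_cycle Fz) by exact: homology_mapP.
have -> : hom_trans g i N (hclass (mk_cycle Fz)) = hclass (mk_cycle Gz).
  exact: homology_mapP.
apply: homology_mapP; rewrite /= /tens_map_fun.
by rewrite (tmap_comp (f'' := g i \o f i) (g'' := idfun)).
Qed.

Lemma hom_trans_id (X : complex R^c) i (N : lmodType R) x :
  hom_trans (id_chain X) i N x = x.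
Proof.
have [z <-] := hclass_surj x.
by apply: homology_mapP; rewrite /= /tens_map_fun tmap_idfun.
Qed.

Lemma hom_trans_bij (X Y : complex R^c) (f : chain_map X Y) (i : int) (N : lmodType R) :
  (forall j : int, i - 1 <= j -> bijective (f j)) -> bijective (hom_trans f i N).
Proof.
move=> fB; apply: homology_map_bij => j /fB/linear_inverse[g [fK gK]].
exists (tmap g (idfun : {linear N -> N})) => x; rewrite /= /tens_map_fun.
  by rewrite (tmap_comp (f'' := idfun) (g'' := idfun)) ?tmap_idfun.
by rewrite (tmap_comp (f'' := idfun) (g'' := idfun)) ?tmap_idfun.
Qed.

(** Comparison maps in both directions compose to maps over the identity of [M], which induce the
    identity by homotopy. *)
Lemma comparison_bij (M : lmodType R^c) (P Q : proj_resolution M) (f : chain_map P Q) :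
  (forall x, pres_aug Q (f 0 x) = pres_aug P x) ->
  forall i (N : lmodType R), bijective (hom_trans f i N).
Proof.
move=> fE i N; have [g gE] := comparison Q P.
exists (hom_trans g i N) => x; rewrite -hom_trans_comp.
  by rewrite (@hom_trans_homotopy _ _ _ _ (id_chain P)) ?hom_trans_id// => y; rewrite /= gE fE.
by rewrite (@hom_trans_homotopy _ _ _ _ (id_chain Q)) ?hom_trans_id// => y; rewrite /= fE gE.
Qed.

End ComparisonHomology.

(** * Gorenstein flatness and acyclicity *)

Section FreeTensor.
Variables (k : comPzRingType) (R : algebra k) (E : lmodType R).

Let free_delta (p : E) : free_mod E :=
  exist (fun f => finsupp_pred f) (fun q => ((q == p)%:R : (R : pzRingType)^o)) (delta_finsupp p).

Let free_expand (f : free_mod E) : exists s : seq E, forall t, uniq t -> {subset s <= t} ->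
  f = \sum_(p <- t) (val f p : R) *: free_delta p.
Proof.
have [s [us fs]] := carries_ex f; exists s => t ut st; apply/val_inj/funext => q.
rewrite [val (\sum_(p <- t) _)](raddf_sum val) fct_sumE.
rewrite [RHS](_ : _ = \sum_(p <- t) (val f p : R) * (q == p)%:R); last exact: eq_bigr.
have [qt|qt] := boolP (q \in t).
  rewrite (big_rem q qt) /= eqxx mulr1 big_seq big1 ?addr0// => p.
  rewrite mem_rem_uniq// inE eq_sym => /andP[/negPf-> _].
  by rewrite mulr0.
rewrite fs; last by apply: contra qt; exact: st.
rewrite big_seq big1// => p pt; rewrite (_ : (q == p) = false) ?mulr0//.
by apply: contraNF qt => /eqP->.
Qed.

(** A tensor is a finite sum of its coordinates against the basis of deltas, so exactness can be
    checked coordinatewise. *)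
Lemma free_tensor_exact (X Y Z : lmodType R^c) (a : {linear X -> Y}) (b : {linear Y -> Z}) :
  exact_pair a b ->
  exact_pair (tmap a (idfun : {linear free_mod E -> free_mod E}))
             (tmap b (idfun : {linear free_mod E -> free_mod E})).
Proof.
move=> ab.
(* The [p]-th coordinate on pure tensors; [e] below extends it to all tensors. *)
pose c (W : lmodType R^c) p (m : W) (f : free_mod E) : W := ((val f p : R) : R^c) *: m.
have cDl (W : lmodType R^c) p (m m' : W) n : c W p (m + m') n = c W p m n + c W p m' n.
  by rewrite /c scalerDr.
have cDr (W : lmodType R^c) p (m : W) n n' : c W p m (n + n') = c W p m n + c W p m n'.
  by rewrite /c -scalerDl.
have cZ (W : lmodType R^c) p (m : W) (r : R) n : c W p ((r : R^c) *: m) n = c W p m (r *: n).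
  by rewrite /c scalerA.
pose e W p (x : tensor W (free_mod E)) : W := tens_zlift (c W p) x.
have eD (W : lmodType R^c) p x y : e W p (x + y) = e W p x + e W p y.
  exact: tens_zliftD (cDl W p) (cDr W p) (cZ W p) x y.
have eP (W : lmodType R^c) p m n : e W p (pure m n) = c W p m n.
  exact: tens_zlift_pure (cDl W p) (cDr W p) (cZ W p) m n.
have e0 (W : lmodType R^c) p : e W p 0 = 0 by apply: (addIr (e W p 0)); rewrite -eD !add0r.
have eN (W : lmodType R^c) p x : e W p (- x) = - e W p x.
  by apply: (addIr (e W p x)); rewrite -eD !addNr e0.
have eb p x : e Z p (tmap b (idfun : {linear free_mod E -> free_mod E}) x) = b (e Y p x).
  elim/tens_ind: x => [|m n|x IH|x y IHx IHy].
  - by rewrite raddf0 !e0 raddf0.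
  - by rewrite tmap_pure !eP /c linearZ.
  - by rewrite raddfN /= !eN IH raddfN.
  - by rewrite raddfD /= !eD IHx IHy raddfD.
have pure0 (n : free_mod E) : pure (0 : Y) n = 0.
  by apply: (addIr (pure 0 n)); rewrite -pureDl !add0r.
have pure0r (m : Y) : pure m (0 : free_mod E) = 0.
  by apply: (addIr (pure m 0)); rewrite -pureDr !add0r.
have pure_sum (s : seq E) (F : E -> free_mod E) (m : Y) :
    pure m (\sum_(p <- s) F p) = \sum_(p <- s) pure m (F p).
  by apply: (big_morph (pure m)) => [x y|]; [exact: pureDr|exact: pure0r].
have expand x : exists s : seq E, forall t, uniq t -> {subset s <= t} ->
    x = \sum_(p <- t) pure (e Y p x) (free_delta p).
  elim/tens_ind: x => [|m n|x [s IH]|x y [s IHx] [s' IHy]].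
  - by exists [::] => t _ _; rewrite big1// => p _; rewrite e0 pure0.
  - have [s sE] := free_expand n; exists s => t ut st.
    rewrite {1}(sE t ut st) pure_sum; apply: eq_bigr => p _.
    by rewrite -pureZ eP.
  - exists s => t ut st; rewrite {1}(IH t ut st) -sumrN; apply: eq_bigr => p _.
    by rewrite eN; apply: (addIr (pure (e Y p x) (free_delta p))); rewrite -pureDl !addNr pure0.
  - exists (s ++ s') => t ut st.
    have sst : {subset s <= t} by move=> p ps; apply: st; rewrite mem_cat ps.
    have s't : {subset s' <= t} by move=> p ps; apply: st; rewrite mem_cat ps orbT.
    rewrite {1}(IHx t ut sst) {1}(IHy t ut s't) -big_split.
    by apply: eq_bigr => p _; rewrite eD pureDl.
move=> x; split=> [bx|[y <-]]; last first.
  rewrite /= (tmap_comp (f'' := \0) (g'' := idfun))//; first by apply: tmap0; left.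
  by move=> z; apply/ab; exists z.
have [s /(_ _ (undup_uniq s))->] := expand x; last by move=> p; rewrite mem_undup.
have ex p : exists w, a w = e Y p x.
  by apply/ab; rewrite -eb bx e0.
exists (\sum_(p <- undup s) pure (projT1 (cid (ex p))) (free_delta p)).
rewrite raddf_sum; apply: eq_bigr => p _; rewrite /= tmap_pure /=.
by case: cid => w /= ->.
Qed.

End FreeTensor.

Section TensorRightExact.
Variables (k : comPzRingType) (R : algebra k).

Lemma tmap_surjl (M M' : lmodType R^c) (N : lmodType R) (g : {linear M -> M'}) :
  onto g -> onto (tmap g (idfun : {linear N -> N})).
Proof.
move=> gs; elim/tens_ind => [|m n|x [y <-]|x y [x' <-] [y' <-]].
- by exists 0; rewrite raddf0.
- by have [m' <-] := gs m; exists (pure m' n); exact: tmap_pure.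
- by exists (- y); rewrite raddfN.
- by exists (x' + y'); rewrite raddfD.
Qed.

Lemma pure_oppl (M : lmodType R^c) (N : lmodType R) (m m' : M) (n : N) :
  pure (m - m') n = pure m n - pure m' n.
Proof. by apply: (addIr (pure m' n)); rewrite -pureDl !subrK. Qed.

(** A set-theoretic section [s] of [g] defines a map from the right-hand tensor product to the
    cokernel of [F]; by [bE] it does not depend on the choice of preimages. *)
Lemma tmap_exactl (M M' M'' : lmodType R^c) (N : lmodType R)
    (f : {linear M -> M'}) (g : {linear M' -> M''}) :
  exact_pair f g -> onto g ->
  exact_pair (tmap f (idfun : {linear N -> N})) (tmap g (idfun : {linear N -> N})).
Proof.
move=> fg gs x; split=> [gx|[y <-]]; last first.
  rewrite /= (tmap_comp (f'' := \0) (g'' := idfun)) //.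
    by apply: tmap0; left.
  by move=> z; apply/fg; exists z.
pose F := tmap f (idfun : {linear N -> N}).
pose s m := projT1 (cid (gs m)).
have gK m : g (s m) = m by rewrite /s; case: cid.
pose b m (n : N) : cokernel F := to_coker F (pure (s m) n).
have bE m m' n : g m = m' -> b m' n = to_coker F (pure m n).
  move=> gm; apply/to_coker_eq; rewrite -pure_oppl.
  have /fg[u fu] : g (s m' - m) = 0 by rewrite linearB /= gK gm subrr.
  by exists (pure u n); rewrite -fu; exact: tmap_pure.
have bDl m m' n : b (m + m') n = b m n + b m' n.
  by rewrite (bE (s m + s m')) ?linearD /= ?gK// pureDl linearD.
have bDr m n n' : b m (n + n') = b m n + b m n' by rewrite /b pureDr linearD.
have bZ m (r : R) n : b ((r : R^c) *: m) n = b m (r *: n).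
  by rewrite (bE ((r : R^c) *: s m)) ?linearZ /= ?gK// pureZ.
have hE y : tens_zlift b (tmap g (idfun : {linear N -> N}) y) = to_coker F y.
  have hD := tens_zliftD bDl bDr bZ.
  have h0 : tens_zlift b 0 = 0.
    by apply: (addIr (tens_zlift b 0)); rewrite -hD !add0r.
  elim/tens_ind: y => [|m n|y IH|y z IHy IHz].
  - by rewrite !raddf0.
  - by rewrite tmap_pure tens_zlift_pure//; apply: bE.
  - rewrite !raddfN /= -IH; apply: (addIr (tens_zlift b (tmap g idfun y))).
    by rewrite -hD !addNr.
  - by rewrite !raddfD /= hD IHy IHz.
have /to_coker_eq0[y] : to_coker F x = 0.
  rewrite -hE gx; apply: (addIr (tens_zlift b 0)).
  by rewrite -(tens_zliftD bDl bDr bZ) !add0r.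
by exists y.
Qed.

Lemma tmapC (M M' : lmodType R^c) (N N' : lmodType R)
    (d : {linear M -> M'}) (g : {linear N -> N'}) x :
  tmap d (idfun : {linear N' -> N'}) (tmap (idfun : {linear M -> M}) g x) =
  tmap (idfun : {linear M' -> M'}) g (tmap d (idfun : {linear N -> N}) x).
Proof.
rewrite (tmap_comp (f'' := d) (g'' := g))//.
by rewrite (tmap_comp (f'' := d) (g'' := g)).
Qed.

End TensorRightExact.

(* With 0 -> L -> F -> E -> 0 exact and F free, the vanishing of Tor_1(G, E) is the
   injectivity of G (x) L -> G (x) F, a condition in which no resolution of G occurs. *)
Section TorOne.
Variables (k : comPzRingType) (R : algebra k).
Variables (G : lmodType R^c) (E : lmodType R).

Let ev : {linear free_mod E -> E} := free_ev (P := E).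
Let incl : {linear kernel ev -> free_mod E} := val.

Let incl_ev : exact_pair incl ev.
Proof. by move=> f; split=> [f0|[x <-]]; [exists (to_kernel f0)|exact: kernelP]. Qed.
Let ev_onto : onto ev. Proof. exact: free_ev_surj. Qed.

Variables (X2 X1 X0 : lmodType R^c).
Variables (d2 : {linear X2 -> X1}) (d1 : {linear X1 -> X0}) (q : {linear X0 -> G}).
Hypothesis d1q : exact_pair d1 q.
Hypothesis qs : onto q.

Let idN (N : lmodType R) : {linear N -> N} := idfun.
Let idM (M : lmodType R^c) : {linear M -> M} := idfun.

Definition exact_at_one := forall x, tmap d1 (idN E) x = 0 ->
  exists y, tmap d2 (idN E) y = x.

(** Lift [g] to [a] over [X0]; its image over the free module is a boundary of some [b]. Exactness
    over [E] corrects [b] to come from the kernel, and flatness of [X0] identifies [a] with a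
    boundary. *)
Lemma kernel_inj_of_exact_at_one : (forall x, d1 (d2 x) = 0) -> flat_mod X0 -> exact_at_one ->
  forall g, tmap (idM G) incl g = 0 -> g = 0.
Proof.
move=> d12 flat0 ex g g0.
have [a ag] := tmap_surjl qs g; rewrite -ag in g0 *.
move: g0; rewrite -tmapC => /(tmap_exactl d1q qs)[b ba].
have /ex[c' c'b] : tmap d1 (idN E) (tmap (idM X1) ev b) = 0.
  by rewrite tmapC ba; apply/(tmap_exact incl_ev ev_onto); exists a.
have [c cc'] := tmap_surj ev_onto c'.
have /(tmap_exact incl_ev ev_onto)[e ee] :
    tmap (idM X1) ev (b - tmap d2 (idN _) c) = 0.
  by rewrite linearB /= -tmapC cc' c'b subrr.
apply/(tmap_exactl d1q qs); exists e.
apply: (flat0 _ _ incl val_inj); rewrite -tmapC ee linearB /= ba.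
rewrite (tmap_comp (f'' := \0) (g'' := idfun))//.
rewrite (tmap0 (f := \0)) ?subr0//.
by left.
Qed.

(** The converse chase: injectivity corrects a lift [y] of [x] to a cycle over the free module,
    where exactness is preserved. *)
Lemma exact_at_one_of_kernel_inj : exact_pair d2 d1 ->
  (forall g, tmap (idM G) incl g = 0 -> g = 0) -> exact_at_one.
Proof.
move=> d21 inj x dx; have [y yx] := tmap_surj ev_onto x.
have /(tmap_exact incl_ev ev_onto)[a ad] : tmap (idM X0) ev (tmap d1 (idN _) y) = 0.
  by rewrite -tmapC yx.
have /(tmap_exactl d1q qs)[w wa] : tmap q (idN _) a = 0.
  apply: inj; rewrite -tmapC ad.
  by apply/(tmap_exactl d1q qs); exists y.
have /(free_tensor_exact d21)[z zy] : tmap d1 (idN _) (y - tmap (idM X1) incl w) = 0.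
  by rewrite linearB /= tmapC wa ad subrr.
exists (tmap (idM X2) ev z); rewrite tmapC zy linearB /= yx.
rewrite [X in _ - X](_ : _ = 0) ?subr0//.
by apply/(tmap_exact incl_ev ev_onto); exists w.
Qed.

End TorOne.

Section Shift.
Variables (A : pzRingType) (T : complex A) (n : int).

Lemma shift_shape (i j : int) x : i <> j + 1 -> diff T (i + n) (j + n) x = 0.
Proof. by move=> ij; apply: diff_shape; lia. Qed.

Definition shift : complex A :=
  Complex shift_shape (fun i j l x => @diff_diff _ T (i + n) (j + n) (l + n) x).

(** Shifting brings any cokernel in [T] to the position named in [gorenstein_projective]. *)
Lemma shift_totally_acyclic : totally_acyclic T -> totally_acyclic shift.
Proof.
move=> [projT acT homT]; split=> [i|i x|P projP i phi]; first exact: projT.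
  rewrite /=; have -> : i - 1 + n = i + n - 1 by lia.
  have -> : i + 1 + n = i + n + 1 by lia.
  exact: acT.
move=> /=; have -> : i - 1 + n = i + n - 1 by lia.
have -> : i + 1 + n = i + n + 1 by lia.
exact: homT.
Qed.
End Shift.

(** * Vanishing of Tate homology on injectives and its consequence *)

Section Vanishing.
Variables (k : comPzRingType) (R : algebra k).

Lemma homology_eq0 (A : pzRingType) (X : complex A) :
  acyclic X -> forall i (c : homology X i), c = 0.
Proof.
move=> acX i c; have [z <-] := hclass_surj c; apply/hclass_eq0.
exact/acX/cycle_diff.
Qed.

Lemma acyclic_of_homology (A : pzRingType) (X : complex A) :
  (forall i (c : homology X i), c = 0) -> acyclic X.
Proof. by move=> h0 i x dx; have /hclass_eq0 := h0 i (hclass (mk_cycle dx)). Qed.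

Lemma acyclic_exact (A : pzRingType) (X : complex A) (l i j : int) :
  acyclic X -> l = i + 1 -> i = j + 1 -> exact_pair (diff X l i) (diff X i j).
Proof.
move=> acX -> ij; have -> : j = i - 1 by lia.
by move=> x; split=> [/acX//|[y <-]]; exact: diff_diff.
Qed.

(** The injectivity criterion depends only on [G] and [E], so it transfers exactness from the flat
    complex defining [G] to the given sequence. *)
Lemma gorenstein_flat_exact_at_one (G : lmodType R^c) (E : lmodType R) :
  gorenstein_flat G -> injective_mod E ->
  forall (X2 X1 X0 : lmodType R^c) (d2 : {linear X2 -> X1}) (d1 : {linear X1 -> X0})
    (q : {linear X0 -> G}),
    exact_pair d2 d1 -> exact_pair d1 q -> onto q -> exact_at_one E d2 d1.
Proof.
move=> [F [flatF acF [h hB] acFE]] injE X2 X1 X0 d2 d1 q d21 d1q qs.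
pose p : {linear F 0 -> G} := h \o to_coker (diff F 1 0).
apply: (exact_at_one_of_kernel_inj d1q qs d21).
apply: (@kernel_inj_of_exact_at_one _ _ G E (F 2) (F 1) (F 0) (diff F 2 1) (diff F 1 0) p).
- move=> x; rewrite -to_coker_eq0 /=; split=> [hx|->]; last exact: linear0.
  by apply: (bij_inj hB); rewrite hx linear0.
- move=> g; have [h' _ h'K] := hB; have [x xE] := to_coker_surj (h' g).
  by exists x; rewrite /= xE h'K.
- exact: diff_diff.
- exact: flatF.
- by move=> x; exact: (@acFE E injE 1).
Qed.

Lemma totally_acyclic_tensor (T : complex R^c) (E : lmodType R) :
  (forall G : lmodType R^c, gorenstein_projective G -> gorenstein_flat G) ->
  totally_acyclic T -> injective_mod E -> acyclic (tens_cpx T E).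
Proof.
move=> gpf tacT injE i.
(* Degree [1 + n] of [T] is degree 1 of [shift T n]. *)
have [n ->] : exists n, i = 1 + n by exists (i - 1); lia.
move=> x; pose G := cokernel (diff (shift T n) 1 0).
have gG : gorenstein_flat G.
  apply: gpf; exists (shift T n); split; first exact: shift_totally_acyclic.
  by exists (idfun : {linear G -> G}); exists id.
have [_ acS _] := shift_totally_acyclic n tacT.
have ex := @gorenstein_flat_exact_at_one G E gG injE _ _ _
  (diff (shift T n) 2 1) (diff (shift T n) 1 0) (to_coker (diff (shift T n) 1 0))
  (@acyclic_exact _ _ 2 1 0 acS erefl erefl) (to_coker_eq0 _) (@to_coker_surj _ _ _ _).
have -> : 1 + n - 1 = 0 + n by lia.
have -> : 1 + n + 1 = 2 + n by lia.
exact: ex.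
Qed.

Lemma functor_iso_refl (F : mod_functor R) : functor_iso F F.
Proof.
exists (@NatTrans _ _ F F (fun N => idfun) (fun _ _ _ _ => erefl)) => N.
by exists id.
Qed.

Lemma tate_J_completion (M : lmodType R^c) (P : proj_resolution M)
    (X : complete_resolution M) :
  (forall E : lmodType R, injective_mod E -> acyclic (tens_cpx (cres_tate X) E)) ->
  exists (C : functor_family R) (tau : family_map C (tor P)),
    J_completion tau /\ forall i : int, functor_iso (C i) (tate_tor X i).
Proof.
move=> acT; have [projT _ _] := cres_tac X.
have flatT i : flat_mod (cres_tate X i) := projective_flat (projT i).
have [f fE] := comparison (cres_proj X) P.
have [n isoX] := cres_iso X.
(* The resolution inside [X] may differ from [P], so the Tate complex reaches [P] through a
   comparison map. *)
pose phi := comp_chain (cres_map X) f.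
exists (flat_homology flatT), (hom_family_map flatT phi).
split; last by move=> i; exact: functor_iso_refl.
(* The bound is [n + 1] because homology in degree [i] also involves degree [i - 1]. *)
apply: (@J_completion_of_stable _ _ _ _ _ (n + 1)).
  split; last by move=> s _; exact: flat_homology_long_exact.
  by move=> E injE i x; apply: homology_eq0; exact: acT.
move=> i ni N; apply: (eq_bij (f := hom_trans f i N \o hom_trans (cres_map X) i N)).
  apply: bij_comp; first exact: comparison_bij.
  by apply: hom_trans_bij => j ij; apply: isoX; lia.
by move=> x; rewrite /= -hom_trans_comp.
Qed.

End Vanishing.

(* The brutal truncation in degrees [>= 0]; it is a quotient complex, hence the
   cokernels instead of a case distinction on the objects. *)
Section Truncation.
Variables (A : pzRingType) (T : complex A).
Hypothesis tacT : totally_acyclic T.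

Definition cut (i : int) : {linear T i -> T i} :=
  if i < 0 then (idfun : {linear T i -> T i}) else (\0 : {linear T i -> T i}).
Definition trunc_obj i : lmodType A := cokernel (cut i).

Lemma cut_nneg i x : 0 <= i -> cut i x = 0.
Proof. by rewrite /cut leNgt => /negPf->. Qed.
Lemma cut_neg i x : i < 0 -> cut i x = x.
Proof. by rewrite /cut => ->. Qed.

Definition to_trunc i : {linear T i -> trunc_obj i} := to_coker (cut i).

Lemma to_trunc_inj i : 0 <= i -> injective (to_trunc i).
Proof.
move=> i0 x y /to_coker_eq[z]; rewrite cut_nneg// => /esym/eqP.
by rewrite subr_eq0 => /eqP.
Qed.
Lemma to_trunc_surj i : onto (to_trunc i).
Proof. exact: to_coker_surj. Qed.
Lemma trunc_neg i (x : trunc_obj i) : i < 0 -> x = 0.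
Proof.
move=> i0; have [y <-] := to_trunc_surj x.
by apply/to_coker_eq0; exists y; exact: cut_neg.
Qed.

(** Out of a negative degree the differential lands in a negative degree, where the truncation is
    0. *)
Lemma trunc_diff_subproof i j x : (to_trunc j \o diff T i j) (cut i x) = 0.
Proof.
have [i0|i0] := leP 0 i; first by rewrite cut_nneg// linear0.
have [ij|ij] := pselect (i = j + 1).
  by apply: trunc_neg; lia.
by rewrite /= diff_shape// linear0.
Qed.

Definition trunc_diff i j : {linear trunc_obj i -> trunc_obj j} :=
  coker_lift (@trunc_diff_subproof i j).

Lemma trunc_diffE i j x : trunc_diff i j (to_trunc i x) = to_trunc j (diff T i j x).
Proof. exact: coker_liftE. Qed.

Lemma trunc_diff_shape i j x : i <> j + 1 -> trunc_diff i j x = 0.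
Proof.
move=> ij; have [y <-] := to_trunc_surj x.
by rewrite trunc_diffE diff_shape// linear0.
Qed.
Lemma trunc_diff_diff i j l x : trunc_diff j l (trunc_diff i j x) = 0.
Proof.
have [y <-] := to_trunc_surj x.
by rewrite !trunc_diffE diff_diff linear0.
Qed.
Definition trunc : complex A := Complex trunc_diff_shape trunc_diff_diff.

Definition to_trunc_map : chain_map T trunc :=
  ChainMap (Y := trunc) (chain_fun := to_trunc) (fun i j x => esym (@trunc_diffE i j x)).

Let M : lmodType A := cokernel (diff T 1 0).
Let to_M : {linear T 0 -> M} := to_coker (diff T 1 0).

Lemma trunc_aug_subproof x : to_M (cut 0 x) = 0.
Proof. by rewrite cut_nneg// linear0. Qed.
Definition trunc_aug : {linear trunc 0 -> M} := coker_lift trunc_aug_subproof.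
Lemma trunc_augE x : trunc_aug (to_trunc 0 x) = to_M x.
Proof. exact: coker_liftE. Qed.

Lemma trunc_proj i : projective_mod (trunc i).
Proof.
have [projT _ _] := tacT.
move=> U V p h ps; have [i0|i0] := leP 0 i; last first.
  by exists \0 => x; rewrite (trunc_neg x i0) !linear0.
have [h' h'E] := projT i _ _ p (h \o to_trunc i) ps.
have h'0 x : h' (cut i x) = 0 by rewrite cut_nneg// linear0.
exists (coker_lift h'0) => x; have [y <-] := to_trunc_surj x.
by rewrite /= coker_liftE h'E.
Qed.

Lemma trunc_exact i : 0 < i -> exact_pair (diff trunc (i + 1) i) (diff trunc i (i - 1)).
Proof.
have [_ acT _] := tacT.
move=> i0 x; split=> [|[y <-]]; last exact: diff_diff.
have [y <-] := to_trunc_surj x; rewrite [diff _ _ _ _]trunc_diffE -(linear0 (to_trunc (i - 1))).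
move=> /to_trunc_inj dy; have [|z zy] := acT i y; first by apply: dy; lia.
by exists (to_trunc _ z); rewrite -zy [LHS]trunc_diffE.
Qed.

Lemma trunc_exact0 : exact_pair (diff trunc 1 0) trunc_aug.
Proof.
move=> x; have [y <-] := to_trunc_surj x; rewrite trunc_augE to_coker_eq0.
split=> [[z <-]|[w]]; first by exists (to_trunc 1 z); exact: trunc_diffE.
have [z <-] := to_trunc_surj w; rewrite [diff _ _ _ _]trunc_diffE.
by move=> /to_trunc_inj zy; exists z; exact: zy.
Qed.

Lemma trunc_surj : onto trunc_aug.
Proof.
by move=> m; have [x <-] := to_coker_surj m; exists (to_trunc 0 x); exact: trunc_augE.
Qed.

Definition trunc_resolution : proj_resolution M :=
  ProjResolution trunc_proj (@trunc_neg) trunc_exact trunc_exact0 trunc_surj.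

Lemma to_trunc_iso : exists n : int, forall i, n <= i -> bijective (to_trunc_map i).
Proof.
exists 0 => i i0; apply: inj_onto_bij; first exact: to_trunc_inj.
exact: to_trunc_surj.
Qed.

Definition trunc_complete : complete_resolution M :=
  CompleteResolution (cres_proj := trunc_resolution) tacT to_trunc_iso.

End Truncation.

Theorem proposition3p5 (k : comPzRingType) (R : algebra k) :
  (forall G : lmodType R^c, gorenstein_projective G -> gorenstein_flat G) <->
  (forall (M : lmodType R^c) (P : proj_resolution M) (X : complete_resolution M),
     exists (C : functor_family R) (tau : family_map C (tor P)),
       J_completion tau /\
       forall i : int, functor_iso (C i) (tate_tor X i)).
Proof.
split=> [gpf M P X|compl G [T [tacT isoG]]].
  apply: tate_J_completion => E; exact: totally_acyclic_tensor gpf (cres_tac X).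
(* Projective modules being flat, [T] itself can witness Gorenstein flatness. *)
have [projT acT _] := tacT; exists T; split=> // [i|E injE].
  exact/projective_flat/projT.
have [C [tau [[[CE _] _] iso]]] := compl _ (trunc_resolution tacT) (trunc_complete tacT).
(* Each Tate class on [E] is the image under [eta] of an element of [C i E], which is 0. *)
apply: acyclic_of_homology => i c; have [eta /(_ E)[g etaK gK]] := iso i.
by rewrite -[c]gK (CE E injE i (g c)) linear0.
Qed.
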